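(* Let $p\ge 0$, $q\ge 0$ with $p+q>0$. Put $r_0=1$ and, for $n\ge 1$, $r_n=\frac{1}{n!}\sum_{P\in\mathcal{ONC}_{2n}^2}w(P)$. Define $m_n=r_k$ if $n=2k$ and $m_n=0$ if $n$ is odd. Then $(m_n)_{n\ge 0}$ is the sequence of moments of the Kesten measure $\mu_{p,q}$, and $\mu_{p,q}$ is the unique probability measure on $\mathbb{R}$ with these moments.
   Context: A partition of $[n]=\{1,\dots,n\}$ is non-crossing if there are no $k<m<k'<m'$ with $k,k'$ in one block and $m,m'$ in a different block. For distinct blocks $B,B'$ of a non-crossing partition write $B<B'$ ($B'$ is inner with respect to $B$, and $B$ is outer with respect to $B'$) if there are $a,b\in B$ with $a<c<b$ for all $c\in B'$. Write $B\prec B'$ if $B<B'$ and there is no block $B''$ of the partition with $B<B''<B'$. An ordered non-crossing partition of $[n]$ is a sequence $P=(P_1,\dots,P_k)$ listing all blocks of a non-crossing partition of $[n]$, each exactly once, in an arbitrary order. $\mathcal{ONC}_{n}^2$ is the set of ordered non-crossing partitions of $[n]$ all of whose blocks have two elements. Let $e(P)$ (number of disorders) be the number of pairs $i<j$ with $P_j\prec P_i$, and $e'(P)$ (number of orders) the number of pairs $i<j$ with $P_i\prec P_j$. The weight is $w(P)=p^{e(P)}q^{e'(P)}$, with $0^0=1$. The Kesten measure $\mu_{p,q}$ is the probability measure on $\mathbb{R}$ whose absolutely continuous part has density $$f_{p,q}(x)=\frac{1}{\pi}\,\frac{\sqrt{2(p+q)-x^2}}{2-(2-p-q)x^2},\qquad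 x\in[-\sqrt{2(p+q)},\sqrt{2(p+q)}],$$ (and density $0$ outside this interval), and which has in addition, exactly when $p+q<1$, two atoms of equal mass at $x=\pm\frac{1}{\sqrt{1-(p+q)/2}}$ (the masses being determined by the total mass being $1$). *)

(* Defs.v *)
From HB Require Import structures.
From mathcomp Require Import all_boot all_order all_algebra.

Set Implicit Arguments.
Unset Strict Implicit.
Unset Printing Implicit Defensive.

Section OrderedNonCrossingPartitions.
Local Open Scope set_scope.
Local Open Scope nat_scope.

(* The ground set {1, ..., n} is represented by 'I_n = {0, ..., n - 1}, with
   its usual order. *)
Variable n : nat.
Implicit Types (pi : {set {set 'I_n}}) (B C D : {set 'I_n}).

Definition crossing B C : bool :=
  [exists k in B, exists k' in B, exists m in C, exists m' in C,
     [&& k < m, m < k' & k' < m']].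

Definition noncrossing pi : bool :=
  [forall B in pi, forall C in pi, (B != C) ==> ~~ crossing B C].

(* B < C : the block C is inner with respect to B *)
Definition outer B C : bool :=
  (B != C) && [exists a in B, exists b in B, forall c in C, a < c < b].

Definition directly_outer pi B C : bool :=
  outer B C && ~~ [exists D in pi, outer B D && outer D C].

Definition ordered_noncrossing (P : seq {set 'I_n}) : bool :=
  [&& uniq P, partition [set:: P] [set: 'I_n] & noncrossing [set:: P]].

Definition ordered_noncrossing_pair (P : seq {set 'I_n}) : bool :=
  ordered_noncrossing P && all (fun B => #|B| == 2) P.

Definition disorders (P : seq {set 'I_n}) : nat :=
  #|[set ij : 'I_(size P) * 'I_(size P) | (ij.1 < ij.2) &&
      directly_outer [set:: P] (nth set0 P ij.2) (nth set0 P ij.1)]|.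

Definition orders (P : seq {set 'I_n}) : nat :=
  #|[set ij : 'I_(size P) * 'I_(size P) | (ij.1 < ij.2) &&
      directly_outer [set:: P] (nth set0 P ij.1) (nth set0 P ij.2)]|.

Lemma size_ordered_noncrossing_pair (P : seq {set 'I_n}) :
  ordered_noncrossing_pair P -> (size P).*2 = n.
Proof.
case/andP=> /and3P[uP pP _] /allP P2.
have := card_partition pP; rewrite cardsT card_ord.
rewrite (eq_bigr (fun=> 2)); last by move=> B; rewrite inE => /P2/eqP.
by rewrite sum_nat_const cardsE (card_uniqP uP) muln2.
Qed.

End OrderedNonCrossingPartitions.

(* Imported only here, so that the finite set notations and names above are
   not shadowed by those of classical_sets. *)
From mathcomp Require Import all_classical all_reals all_analysis.

Import Order.TTheory GRing.Theory Num.Theory.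
Import numFieldNormedType.Exports.

Local Open Scope ring_scope.

Section Moments.
Variable R : realType.

Definition weight (p q : R) (n : nat) (P : seq {set 'I_n}) : R :=
  p ^+ disorders P * q ^+ orders P.

(* By size_ordered_noncrossing_pair, the ordered non-crossing pair partitions
   of [2n] are sequences of length n, so the sum below ranges over all of
   them. *)
Definition r_ (p q : R) (n : nat) : R :=
  if n is 0 then 1 else
  (n`!)%:R^-1 *
    \sum_(P : n.-tuple {set 'I_(n.*2)} | ordered_noncrossing_pair P)
       weight p q P.

Definition m_ (p q : R) (n : nat) : R := if odd n then 0 else r_ p q n./2.

End Moments.

Section KestenMeasure.
Variable R : realType.
Local Open Scope classical_set_scope.

Definition kesten_density (p q x : R) : R :=
  if - Num.sqrt (2 * (p + q)) <= x <= Num.sqrt (2 * (p + q)) then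
    pi^-1 * (Num.sqrt (2 * (p + q) - x ^+ 2) / (2 - (2 - p - q) * x ^+ 2))
  else 0.

Definition kesten_atom (p q : R) : R := (Num.sqrt (1 - (p + q) / 2))^-1.

(* c is the common mass of the two atoms; it is not given explicitly because
   it is determined by mu being a probability measure. *)
Definition is_kesten (p q : R)
    (mu : probability (measurableTypeR R) R) : Prop :=
  exists c : R,
    [/\ p + q < 1 -> 0 < c, 1 <= p + q -> c = 0 &
    forall A : set (measurableTypeR R), measurable A ->
      (mu A = \int[@lebesgue_measure R]_(x in A) (kesten_density p q x)%:E
              + c%:E * (\d_(kesten_atom p q)%R A + \d_(- kesten_atom p q)%R A))%E].

Definition has_moments (mu : probability (measurableTypeR R) R)
    (m : nat -> R) : Prop :=
  forall n : nat,
    mu.-integrable setT (fun x : measurableTypeR R => (x ^+ n)%:E) /\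
    (\int[mu]_x (x ^+ n)%:E)%E = (m n)%:E.

End KestenMeasure.

(* Main.v *)
From HB Require Import structures.
From mathcomp Require Import all_boot all_order all_algebra.
From mathcomp Require Import zify ring lra.
Require Import Defs.

(** Put s = p + q. A sequence P of pair blocks is read as a word: position x
    carries the index of the block that contains x. The words so obtained are
    those in which each letter occurs twice and no two letters alternate, and
    they decompose uniquely as b u b v, where u and v have disjoint alphabets.
    In other words, an ordered noncrossing pair partition is a plane forest
    with labelled nodes, every edge of which has weight p or q according to
    the order of the labels at its two ends ([weight_letter_blocks]).

    Let S and M be the exponential generating series of labelled trees and of
    labelled forests. Splitting off the first tree of a forest gives
    M = 1 + S M ([forests1_rec]). Cutting the edge between the root of a tree
    and its first child leaves an ordered pair of trees, and the two orders of
    such a pair contribute the factors p and q; averaging over them gives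
    S = z + (s / 2) S ^ 2 ([trees_rec]). So only s matters, and elimination of
    the square root yields (2 - s) r_(n+1) = 2 r_n - s sigma_(n+1), where
    sigma_n are the coefficients of S ([forest_coef_rec2]).

    On the analytic side let a ^ 2 = 2 s. The density times the polynomial
    2 - (2 - s) x ^ 2 is sqrt (a ^ 2 - x ^ 2) / pi on [-a, a], and the
    polynomial vanishes at the two atoms. Hence the even moments M_n of the
    Kesten measure satisfy 2 M_n - (2 - s) M_(n+1) = J_n, where J_n is the
    moment of order 2 n of sqrt (a ^ 2 - x ^ 2) / pi. An integration by parts
    shows J_n = s sigma_(n+1) ([integral_semicircle_moment]), so that M_n and
    r_n obey the same recursion with the same initial value
    ([kesten_even_momentE]); the odd moments vanish by symmetry.

    That the masses of the atoms can be chosen to give total mass 1 comes from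
    an explicit primitive of the density, which has mass s / (1 + |1 - s|)
    ([kesten_density_mass]).

    Uniqueness: the even moments of a measure that lives on [-L, L] grow at
    most like the powers of L, which forces every probability measure with the
    same moments to live on [-2 L, 2 L]; and on a bounded interval the
    indicator of a half-line is the pointwise limit of polynomials with values
    in [0, 1] ([moments_determine]). *)

Import Order.TTheory GRing.Theory Num.Theory.

Set Implicit Arguments.
Unset Strict Implicit.
Unset Printing Implicit Defensive.

(** * Noncrossing pairings as words *)

Section Words.
Variable X : finType.
Implicit Types (A B C D : {set X}) (u v w : seq X) (b x y z : X).

(** For distinct letters that occur twice each, the restriction of w to x and
    y tells how the two pairs of positions lie: x y y x when y is nested in x,
    x y x y when they cross. *)
Definition restriction x y w := [seq z <- w | (z == x) || (z == y)].

Definition nested w x y := restriction x y w == [:: x; y; y; x].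

Definition directly_nested w x y :=
  nested w x y && ~~ [exists z, nested w x z && nested w z y].

Definition outermost w y := (y \in w) && ~~ [exists z, nested w z y].

Definition pairing A w :=
  [forall x, count_mem x w == (x \in A).*2] &&
  [forall x, forall y, (x != y) ==> (restriction x y w != [:: x; y; x; y])].

Lemma pairing_count A w x : pairing A w -> count_mem x w = (x \in A).*2.
Proof. by case/andP=> /forallP/(_ x)/eqP. Qed.

Lemma mem_pairing A w : pairing A w -> w =i A.
Proof.
move=> pw x; rewrite -has_pred1 has_count (pairing_count x pw).
by case: (x \in A).
Qed.

Lemma restriction_mem x y w z : z \in restriction x y w -> z \in w.
Proof. by rewrite mem_filter => /andP[]. Qed.

Lemma restrictionC x y w : restriction x y w = restriction y x w.
Proof. by apply: eq_filter => z; rewrite orbC. Qed.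

Lemma restriction_notin x y w : y \notin w -> restriction x y w = nseq (count_mem x w) x.
Proof.
move=> yw; rewrite -size_filter.
have -> : restriction x y w = filter (pred1 x) w.
  apply: eq_in_filter => z zw /=; case: (z =P y) => [zy|]; last by rewrite orbF.
  by rewrite zy (negbTE yw) in zw.
by apply/all_pred1P/allP => z; rewrite mem_filter => /andP[].
Qed.

Lemma restriction_notin2 x y w : x \notin w -> y \notin w -> restriction x y w = [::].
Proof. by move=> xw yw; rewrite restriction_notin// (count_memPn xw). Qed.

Lemma nested_mem w x y : nested w x y -> (x \in w) && (y \in w).
Proof.
move=> /eqP h.
have h1 : x \in restriction x y w by rewrite h !inE eqxx.
have h2 : y \in restriction x y w by rewrite h !inE eqxx orbT.
by move: h1 h2; rewrite !mem_filter => /andP[_ ->] /andP[_ ->].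
Qed.

Lemma pairing_nested A w x y : pairing A w -> nested w x y ->
  (x \in A) && (y \in A).
Proof. by move=> pw /nested_mem; rewrite !(mem_pairing pw). Qed.

Lemma pairing0 w : pairing set0 w = (w == [::]).
Proof.
apply/idP/eqP => [pw|->]; last first.
  by apply/andP; split; apply/forallP => x; rewrite ?inE//; apply/forallP => y; apply/implyP.
case: w pw => // b w pw; have := mem_pairing pw b.
by rewrite !inE eqxx.
Qed.

Section Decomposition.
Variables (b : X) (C D : {set X}) (u v : seq X).
Hypotheses (bC : b \notin C) (bD : b \notin D) (CD : [disjoint C & D]).
Hypotheses (pu : pairing C u) (pv : pairing D v).

Let w := b :: u ++ b :: v.

Let bu : b \notin u. Proof. by rewrite (mem_pairing pu). Qed.
Let bv : b \notin v. Proof. by rewrite (mem_pairing pv). Qed.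
Let inCD x : x \in C -> x \notin v.
Proof. by move=> xC; rewrite (mem_pairing pv) (disjointFr CD xC). Qed.

Let restriction_ne x y : x != b -> y != b ->
  restriction x y w = restriction x y u ++ restriction x y v.
Proof.
move=> xb yb; rewrite /restriction /w /= filter_cat /= ![b == _]eq_sym.
by rewrite (negbTE xb) (negbTE yb).
Qed.

Let restriction_b y : y != b -> restriction b y w =
  b :: nseq (y \in C).*2 y ++ b :: nseq (y \in D).*2 y.
Proof.
move=> yb; rewrite /restriction /w /= eqxx/= filter_cat/= eqxx/=; congr (_ :: _ ++ _ :: _).
  by rewrite -/(restriction b y u) restrictionC restriction_notin// (pairing_count _ pu).
by rewrite -/(restriction b y v) restrictionC restriction_notin// (pairing_count _ pv).
Qed.


(** The letters nested in b are those of u, and otherwise nesting takes place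
    inside u or inside v, since a letter of u and a letter of v follow one
    another. *)
Lemma nested_node x y : nested w x y =
  if x == b then y \in C else if x \in C then nested u x y else nested v x y.
Proof.
rewrite /nested; case: (eqVneq x b) => [->|xb].
  case: (eqVneq y b) => [->|yb].
    rewrite (negbTE bC) /w /restriction /= eqxx/= filter_cat/= eqxx/=.
    by rewrite -!/(restriction _ _ _) !restriction_notin2// !eqseq_cons !andbF.
  rewrite restriction_b//; case: (boolP (y \in C)) => [yC|yC] /=.
    rewrite (disjointFr CD yC) /= . by rewrite eqxx.
  by rewrite !eqseq_cons eqxx eq_sym (negbTE yb).
case: (eqVneq y b) => [->|yb].
  rewrite restrictionC restriction_b// eqseq_cons eq_sym (negbTE xb) /=.
  case: ifP => xC; rewrite restriction_notin// ?(pairing_count _ pu) ?(pairing_count _ pv).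
    by rewrite xC /= !eqseq_cons (negbTE xb) andbF.
  by case: (x \in D) => //=; rewrite !eqseq_cons (negbTE xb) andbF.
rewrite restriction_ne//; case: (boolP (x \in C)) => xC.
  case: (boolP (y \in C)) => yC; first by rewrite (restriction_notin2 (inCD xC) (inCD yC)) cats0.
  have [xy|xy] := eqVneq x y; first by rewrite -xy xC in yC.
  have yu : y \notin u by rewrite (mem_pairing pu).
  rewrite !(restriction_notin _ yu) (pairing_count _ pu) xC /=.
  by rewrite !eqseq_cons (negbTE xy) andbF.
have xu : x \notin u by rewrite (mem_pairing pu).
case: (boolP (y \in C)) => yC; last first.
  by rewrite restriction_notin2// (mem_pairing pu).
rewrite !(restrictionC x y) !(restriction_notin _ xu) (pairing_count _ pu) yC /=.
rewrite (restrictionC y x v) restriction_notin ?inCD//= !eqseq_cons.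
have yx : (y == x) = false by apply/eqP => yx; rewrite yx (negbTE xC) in yC.
rewrite yx (pairing_count _ pv); case: (x \in D) => //=.
by rewrite !eqseq_cons eq_sym yx !andbF.
Qed.

Lemma directly_nested_node x y : directly_nested w x y =
  if x == b then outermost u y
  else if x \in C then directly_nested u x y else directly_nested v x y.
Proof.
rewrite /directly_nested /outermost (mem_pairing pu) nested_node.
have cC z : z \in C -> nested w z y = nested u z y.
  by move=> zC; rewrite nested_node zC; case: eqP bC => // <-; rewrite zC.
have [->|xb] := eqVneq x b.
  congr (_ && ~~ _); apply: eq_existsb => z; rewrite nested_node eqxx.
  case: (boolP (z \in C)) => zC /=; first exact: cC.
  by apply/esym/negP => /(pairing_nested pu); rewrite (negbTE zC).
case: (boolP (x \in C)) => xC.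
  congr (_ && ~~ _); apply: eq_existsb => z; rewrite nested_node (negbTE xb) xC.
  case: (boolP (nested u x z)) => //= /(pairing_nested pu)/andP[_ zC]; exact: cC.
congr (_ && ~~ _); apply: eq_existsb => z; rewrite nested_node (negbTE xb) (negbTE xC).
case: (boolP (nested v x z)) => //= /(pairing_nested pv)/andP[_ zD].
rewrite nested_node (disjointFl CD zD); case: eqP bD => // <-; by rewrite zD.
Qed.

Lemma outermost_node y : outermost w y = (y == b) || outermost v y.
Proof.
rewrite /outermost /w inE mem_cat inE -/w.
have [->|yb] := eqVneq y b; rewrite /= ?orbF.
  apply/existsP => -[z]; rewrite nested_node (negbTE bC).
  case: eqP => // _; case: ifP => _.
    by move=> /(pairing_nested pu); rewrite (negbTE bC) andbF.
  by move=> /(pairing_nested pv); rewrite (negbTE bD) andbF.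
rewrite (mem_pairing pu) (mem_pairing pv).
case: (boolP (y \in C)) => yC /=.
  rewrite (disjointFr CD yC); apply/negbTE; rewrite negbK; apply/existsP; exists b.
  by rewrite nested_node eqxx.
case: (boolP (y \in D)) => yD //=; congr (~~ _).
apply: eq_existsb => z; rewrite nested_node (negbTE yC).
case: (eqVneq z b) => [->|zb].
  by apply/esym/negP => /(pairing_nested pv); rewrite (negbTE bD).
case: ifP => // zC; apply/idP/idP.
  by move=> /(pairing_nested pu); rewrite (negbTE yC) andbF.
by move=> /(pairing_nested pv); rewrite (disjointFr CD zC).
Qed.

Lemma pairing_node : pairing (b |: (C :|: D)) w.
Proof.
apply/andP; split; apply/forallP => x.
  rewrite /w /= count_cat/= (pairing_count _ pu) (pairing_count _ pv) !inE [b == x]eq_sym.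
  have [->|xb] := eqVneq x b; first by rewrite (negbTE bC) (negbTE bD).
  by case: (boolP (x \in C)) => [xC|//]; rewrite (disjointFr CD xC).
apply/forallP => y; apply/implyP => xy.
have [xb|xb] := eqVneq x b.
  rewrite xb in xy *; rewrite restriction_b 1?eq_sym//.
  have yb : (y == b) = false by rewrite eq_sym (negbTE xy).
  by case: (y \in C) => /=; rewrite !eqseq_cons ?(negbTE xy) ?yb ?andbF.
have [yb|yb] := eqVneq y b.
  by rewrite yb restrictionC restriction_b// eqseq_cons eq_sym (negbTE xb).
rewrite restriction_ne//; case: (boolP (x \in C)) => xC.
  case: (boolP (y \in C)) => yC.
    rewrite (restriction_notin2 (inCD xC) (inCD yC)) cats0.
    by move: pu => /andP[_ /forallP/(_ x)/forallP/(_ y)/implyP]; apply.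
  have yu : y \notin u by rewrite (mem_pairing pu).
  rewrite !(restriction_notin _ yu) (pairing_count _ pu) xC /=.
  by rewrite !eqseq_cons (negbTE xy) andbF.
have xu : x \notin u by rewrite (mem_pairing pu).
case: (boolP (y \in C)) => yC; last first.
  rewrite restriction_notin2 ?(mem_pairing pu)//.
  by move: pv => /andP[_ /forallP/(_ x)/forallP/(_ y)/implyP]; apply.
rewrite !(restrictionC x y) !(restriction_notin _ xu) (pairing_count _ pu) yC /=.
by rewrite eqseq_cons eq_sym (negbTE xy).
Qed.

Section Weight.
Variables (R : comNzRingType) (c : X -> X -> R).
Local Open Scope ring_scope.

(** The weight f y of an outermost letter stands for an edge from a virtual
    parent to y. This makes the weight multiplicative along the decomposition
    b u b v, where b becomes the parent of the outermost letters of u. *)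
Definition forest_weight f w : R :=
  (\prod_x \prod_(y | directly_nested w x y) c x y) * \prod_(y | outermost w y) f y.

Lemma forest_weight_node f :
  forest_weight f w = f b * forest_weight (c b) u * forest_weight f v.
Proof.
rewrite /forest_weight.
have -> : \prod_(y | outermost w y) f y = f b * \prod_(y | outermost v y) f y.
  rewrite (eq_bigl _ _ outermost_node) (bigD1 b) ?eqxx//=; congr (_ * _).
  apply: eq_bigl => y; have [->|] := eqVneq y b; last by rewrite andbT.
  by rewrite andbF /outermost (mem_pairing pv) (negbTE bD).
have -> : \prod_x \prod_(y | directly_nested w x y) c x y =
  \prod_(y | outermost u y) c b y * \prod_(x | x != b) \prod_(y | directly_nested w x y) c x y.
  rewrite (bigD1 b)//=; congr (_ * _).
  by apply: eq_bigl => y; rewrite directly_nested_node eqxx.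
suff -> : \prod_(x | x != b) \prod_(y | directly_nested w x y) c x y =
  (\prod_x \prod_(y | directly_nested u x y) c x y) *
  (\prod_x \prod_(y | directly_nested v x y) c x y).
  by ring.
have cu y : directly_nested u b y = false.
  by apply/negP => /andP[/(pairing_nested pu)]; rewrite (negbTE bC).
have cv y : directly_nested v b y = false.
  by apply/negP => /andP[/(pairing_nested pv)]; rewrite (negbTE bD).
rewrite -big_split/= [RHS](bigD1 b)//= (eq_bigl _ _ cu) (eq_bigl _ _ cv) !big_pred0_eq !mul1r.
apply: eq_bigr => x xb.
have [xC|xC] := boolP (x \in C).
  rewrite (eq_bigl (directly_nested u x)); last first.
    by move=> y; rewrite directly_nested_node (negbTE xb) xC.
  rewrite [X in _ * X]big_pred0 ?mulr1// => y.
  by apply/negP => /andP[/(pairing_nested pv)]; rewrite (disjointFr CD xC).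
rewrite (eq_bigl (directly_nested v x)); last first.
  by move=> y; rewrite directly_nested_node (negbTE xb) (negbTE xC).
rewrite [X in X * _]big_pred0 ?mul1r// => y.
by apply/negP => /andP[/(pairing_nested pu)]; rewrite (negbTE xC).
Qed.
End Weight.
End Decomposition.

(** A letter that occurs once between the two occurrences of b and once after
    them would cross b, hence the two parts have disjoint alphabets. *)
Lemma pairing_consP A b w : pairing A (b :: w) ->
  exists u v C, [/\ w = u ++ b :: v, C \subset A :\ b,
     pairing C u & pairing (A :\ b :\: C) v].
Proof.
move=> pw; have bA : b \in A by rewrite -(mem_pairing pw) mem_head.
have bw : count_mem b w = 1 by have := pairing_count b pw; rewrite bA /= eqxx add1n => -[].
have /splitPr bw' : b \in w by rewrite -has_pred1 has_count bw.
case: bw' bw pw => u v; rewrite count_cat/= eqxx => bw pw.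
have {}bw : count_mem b u + (count_mem b v).+1 = 1 := bw.
have bu : b \notin u by rewrite -has_pred1 has_count -eqn0Ngt; lia.
have bv : b \notin v by rewrite -has_pred1 has_count -eqn0Ngt; lia.
have cr x : x \in u -> x \notin v.
  move=> xu; apply/negP => xv.
  have xb : x != b by apply: contraNneq bu => <-.
  have xA : x \in A by rewrite -(mem_pairing pw) !(inE,mem_cat) xu orbT.
  have := pairing_count x pw; rewrite xA /= count_cat/= eq_sym (negbTE xb) => cx.
  have {}cx : count_mem x u + count_mem x v = 2 := cx.
  have cu : count_mem x u = 1.
    by move: xu xv; rewrite -!has_pred1 !has_count; lia.
  have cv : count_mem x v = 1 by lia.
  case/andP: pw => _ /forallP/(_ b)/forallP/(_ x)/implyP; rewrite eq_sym xb => /(_ isT)/eqP; apply.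
  rewrite /restriction /= eqxx/= filter_cat/= eqxx/= -!/(restriction _ _ _).
  by rewrite !(restrictionC b x) !restriction_notin// cu cv.
pose C := [set x in u].
have tru x y : x \in u -> y \in u -> restriction x y (b :: u ++ b :: v) = restriction x y u.
  move=> xu yu; rewrite /restriction /= filter_cat/= -!/(restriction _ _ _).
  have [bx|_] := eqVneq b x; first by rewrite bx xu in bu.
  have [by_|_] := eqVneq b y; first by rewrite by_ yu in bu.
  by rewrite (restriction_notin2 (cr _ xu) (cr _ yu)) cats0.
have trv x y : x \notin u -> y \notin u -> x != b -> y != b ->
   restriction x y (b :: u ++ b :: v) = restriction x y v.
  move=> xu yu xb yb; rewrite /restriction /= filter_cat/= -!/(restriction _ _ _).
  by rewrite ![b == _]eq_sym (negbTE xb) (negbTE yb)/= restriction_notin2.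
have ncr x y : x != y -> restriction x y (b :: u ++ b :: v) != [:: x; y; x; y].
  by move=> xy; case/andP: pw => _ /forallP/(_ x)/forallP/(_ y)/implyP; apply.
exists u, v, C; split => //.
- apply/subsetP => x; rewrite !inE => xu.
  rewrite -(mem_pairing pw) !(inE,mem_cat) xu orbT.
  by case: eqP bu => // <-; rewrite xu.
- apply/andP; split; apply/forallP => x.
    rewrite inE; apply/eqP; case: (boolP (x \in u)) => xu; last exact/count_memPn.
    have xA : x \in A by rewrite -(mem_pairing pw) !(inE,mem_cat) xu orbT.
    have := pairing_count x pw; rewrite xA /= count_cat/= (count_memPn (cr _ xu)).
    by case: eqP bu => [->|_ _]; rewrite ?xu// add0n !addn0.
  apply/forallP => y; apply/implyP => xy; apply/eqP => e.
  have xu : x \in u.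
    by apply: (@restriction_mem x y); rewrite e mem_head.
  have yu : y \in u.
    by apply: (@restriction_mem x y); rewrite e !inE eqxx orbT.
  by have /eqP := ncr _ _ xy; rewrite tru.
- apply/andP; split; apply/forallP => x.
    rewrite !inE; apply/eqP; case: (boolP (x \in u)) => xu /=; first exact/count_memPn/cr.
    have [->|xb] := eqVneq x b; first exact/count_memPn.
    have := pairing_count x pw; rewrite /= count_cat/= (count_memPn xu) eq_sym (negbTE xb).
    by rewrite !add0n => <-.
  apply/forallP => y; apply/implyP => xy; apply/eqP => e.
  have xv : x \in v.
    by apply: (@restriction_mem x y); rewrite e mem_head.
  have yv : y \in v.
    by apply: (@restriction_mem x y); rewrite e !inE eqxx orbT.
  have /eqP := ncr _ _ xy; rewrite trv//.
  + by apply: contraL xv => xu; exact: cr.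
  + by apply: contraL yv => yu; exact: cr.
  + by apply: contraNneq bv => <-.
  + by apply: contraNneq bv => <-.
Qed.

End Words.

(** * Enumeration of the words and recursions for weighted forests *)

Lemma flatten_uniq (I T : eqType) (F : I -> seq T) (s : seq I) :
  uniq s -> (forall i, i \in s -> uniq (F i)) ->
  (forall i j t, i \in s -> j \in s -> t \in F i -> t \in F j -> i = j) ->
  uniq (flatten [seq F i | i <- s]).
Proof.
elim: s => //= i s IH /andP[is_ us] uF dF.
rewrite cat_uniq uF ?mem_head//= IH// ?andbT; first last.
- by move=> j k t js ks; apply: dF; rewrite inE ?js ?ks orbT.
- by move=> j js; apply: uF; rewrite inE js orbT.
apply/hasPn => t /flattenP[_ /mapP[j js ->]] tj; apply/negP => /= ti.
have ij : i = j by apply: dF ti tj; rewrite inE ?eqxx ?js ?orbT.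
by rewrite ij js in is_.
Qed.

Section Enumeration.
Variable X : finType.
Implicit Types (A B C D : {set X}) (u v w : seq X) (b x y z : X).

(** The recursion is on n, which is a bound on the size of the alphabet: the two
    recursive calls use smaller sets, not the predecessor of a set. *)
Fixpoint words n A : seq (seq X) :=
  if A == set0 then [:: [::]] else
  if n is m.+1 then
    flatten [seq flatten [seq
      [seq b :: u ++ b :: v | u <- words m C, v <- words m (A :\ b :\: C)]
      | C <- enum (powerset (A :\ b))] | b <- enum A]
  else [::].

Lemma words0 n : words n set0 = [:: [::]].
Proof. by case: n => [|n]; rewrite /= eqxx. Qed.

Lemma wordsP n A w : A != set0 -> w \in words n.+1 A ->
  exists b C u v, [/\ b \in A, C \subset A :\ b, u \in words n C,
    v \in words n (A :\ b :\: C) & w = b :: u ++ b :: v].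
Proof.
move=> /= /negbTE-> /flattenP[_ /mapP[b bA ->]] /flattenP[_ /mapP[C CA ->]].
move=> /allpairsP[[u v]/= [uw vw ->]].
by exists b, C, u, v; split => //; [rewrite mem_enum in bA | rewrite mem_enum inE in CA].
Qed.

Lemma words_node n A b C u v : b \in A -> C \subset A :\ b ->
  u \in words n C -> v \in words n (A :\ b :\: C) ->
  b :: u ++ b :: v \in words n.+1 A.
Proof.
move=> bA CA uC vD /=; have /negbTE-> : A != set0 by apply/set0Pn; exists b.
apply/flattenP; eexists; first by apply/mapP; exists b => //; rewrite mem_enum.
apply/flattenP; eexists; first by apply/mapP; exists C => //; rewrite mem_enum inE.
by apply/allpairsP; exists (u, v).
Qed.

Lemma node_disjoint A b C : C \subset A :\ b ->
  [/\ b \notin C, b \notin A :\ b :\: C & [disjoint C & A :\ b :\: C]].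
Proof.
move=> CA; split.
- by apply/negP => /(subsetP CA); rewrite !inE eqxx.
- by rewrite !inE eqxx andbF.
- by rewrite -setI_eq0; apply/eqP/setP => x; rewrite !inE; case: (x \in C).
Qed.

Lemma words_pairing n A w : w \in words n A -> pairing A w.
Proof.
elim: n A w => [|n IH] A w.
  by rewrite /=; case: eqP => // ->; rewrite inE pairing0.
have [->|An0] := eqVneq A set0; first by rewrite words0 inE pairing0.
move=> /(wordsP An0)[b [C [u [v [bA CA /IH pu /IH pv ->]]]]].
have [bC bD CD] := node_disjoint CA.
have := pairing_node bC bD CD pu pv; congr (pairing _ _).
apply/setP => x; rewrite !inE; have [->//|xb] := eqVneq x b.
by case: (boolP (x \in C)) => [/(subsetP CA)|]//=; rewrite !inE => /andP[].
Qed.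

Lemma pairing_words n A w : #|A| <= n -> pairing A w -> w \in words n A.
Proof.
elim: n A w => [|n IH] A w.
  by rewrite leqn0 cards_eq0 => /eqP->; rewrite pairing0 words0 inE.
move=> An; case: w => [|b w] pw.
  have -> : A = set0 by apply/setP => x; rewrite -(mem_pairing pw) !inE.
  by rewrite words0 inE.
have bA : b \in A by rewrite -(mem_pairing pw) mem_head.
have [u [v [C [-> CA pu pv]]]] := pairing_consP pw.
have An' : #|A :\ b| <= n by move: An; rewrite (cardsD1 b A) bA.
apply: words_node (IH _ _ _ pu) (IH _ _ _ pv) => //.
- exact: leq_trans (subset_leq_card CA) An'.
- exact: leq_trans (subset_leq_card (subsetDl _ _)) An'.
Qed.

Lemma node_inj b u v b' u' v' : b \notin u -> b' \notin u' ->
  b :: u ++ b :: v = b' :: u' ++ b' :: v' -> [/\ b = b', u = u' & v = v'].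
Proof.
move=> bu bu' [e]; rewrite -{b'}e in bu' *; elim: u u' bu bu' => [|x u IH] [|y u']//=.
- by move=> _ _ [->].
- by rewrite inE => _ /norP[/eqP+ _] [e _]; rewrite e.
- by rewrite inE => /norP[/eqP+ _] _ [e _]; rewrite e.
rewrite !inE => /norP[_ bu] /norP[_ bu'] [-> /(IH _ bu bu')[_ -> ->]].
by split.
Qed.

Lemma words_uniq n A : uniq (words n A).
Proof.
elim: n A => [|n IH] A; first by rewrite /=; case: ifP.
have [->|An0] := eqVneq A set0; first by rewrite words0.
have key b C w : C \subset A :\ b ->
  w \in [seq b :: u ++ b :: v | u <- words n C, v <- words n (A :\ b :\: C)] ->
  exists u v, [/\ b \notin u, u =i C & w = b :: u ++ b :: v].
  move=> CA /allpairsP[[u v]/= [/words_pairing pu _ ->]]; exists u, v.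
  have [bC _ _] := node_disjoint CA.
  by split => //; [rewrite (mem_pairing pu)|exact: mem_pairing].
rewrite /= (negbTE An0); apply: flatten_uniq; first exact: enum_uniq.
  move=> b _; apply: flatten_uniq; first exact: enum_uniq.
    move=> C; rewrite mem_enum inE => CA; apply: allpairs_uniq => // -[u v] [u' v'].
    move=> /allpairsP[[u1 v1]/= [/words_pairing pu _ [-> _]]].
    move=> /allpairsP[[u2 v2]/= [/words_pairing pu' _ [-> _]]] /=.
    have [bC _ _] := node_disjoint CA.
    by move=> /node_inj[]; rewrite ?(mem_pairing pu) ?(mem_pairing pu')// => _ -> ->.
  move=> C C' w; rewrite !mem_enum !inE => CA CA' /(key _ _ _ CA)[u [v [bu uC ->]]].
  move=> /(key _ _ _ CA')[u' [v' [bu' uC' /node_inj[]]]]// _ uu' _.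
  by apply/setP => x; rewrite -uC uu' uC'.
move=> b b' w _ _ /flattenP[_ /mapP[C + ->]] + /flattenP[_ /mapP[C' + ->]].
rewrite !mem_enum !inE => CA /(key _ _ _ CA)[u [v [bu uC ->]]] CA'.
by move=> /(key _ _ _ CA')[u' [v' [bu' uC' /node_inj[]]]].
Qed.

Lemma words_perm n m A : #|A| <= n -> #|A| <= m ->
  perm_eq (words n A) (words m A).
Proof.
move=> An Am; apply: uniq_perm; rewrite ?words_uniq// => w.
by apply/idP/idP => /words_pairing; exact: pairing_words.
Qed.

Section WeightedCount.
Variables (R : comNzRingType) (c : X -> X -> R).
Local Open Scope ring_scope.

Definition forests f A : R := \sum_(w <- words #|A| A) forest_weight c f w.

(** The weights of the forests with a single tree: the root is b, and the edges
    to its children are accounted for by c b. *)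
Definition trees A : R := \sum_(b in A) forests (c b) (A :\ b).

Lemma forestsE f n A : (#|A| <= n)%N ->
  forests f A = \sum_(w <- words n A) forest_weight c f w.
Proof. by move=> An; apply: perm_big; exact: words_perm. Qed.

Lemma forests0 f : forests f set0 = 1.
Proof.
rewrite /forests words0 big_seq1 /forest_weight.
rewrite [X in _ * X]big_pred0// mulr1 big1// => x _; rewrite big_pred0// => y.
Qed.

Lemma forests_rec f A : A != set0 ->
  forests f A = \sum_(b in A) \sum_(C in powerset (A :\ b))
    f b * forests (c b) C * forests f (A :\ b :\: C).
Proof.
move=> An0; have [n An] : exists n, #|A| = n.+1.
  by case: #|A| (cards_eq0 A) => [|n _]; [rewrite (negbTE An0)|exists n].
rewrite {1}/forests An /= (negbTE An0) big_flatten big_map big_enum/=.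
apply: eq_bigr => b bA; rewrite big_flatten big_map big_enum/=.
apply: eq_bigr => C; rewrite inE => CA; rewrite big_allpairs_dep.
have An' : (#|A :\ b| <= n)%N by move: An; rewrite (cardsD1 b A) bA add1n => -[->].
have -> := @forestsE (c b) n C (leq_trans (subset_leq_card CA) An').
have -> := @forestsE f n (A :\ b :\: C) (leq_trans (subset_leq_card (subsetDl _ _)) An').
have [bC bD CD] := node_disjoint CA.
rewrite -mulrA big_distrl mulr_sumr/= big_seq [RHS]big_seq.
apply: eq_bigr => u /words_pairing pu.
rewrite mulr_sumr mulr_sumr big_seq [RHS]big_seq; apply: eq_bigr => v /words_pairing pv.
by rewrite (forest_weight_node bC bD CD pu pv) mulrA.
Qed.

(** Choosing a root b and then the other labels C of its tree amounts to choosing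
    the label set B = b |: C of the tree and then its root. *)
Lemma exchange_subset A (g : X -> {set X} -> R) :
  \sum_(b in A) \sum_(C in powerset (A :\ b)) g b C =
  \sum_(B in powerset A) \sum_(b in B) g b (B :\ b).
Proof.
rewrite [RHS](exchange_big_dep (mem A))/=; last first.
  by move=> B b; rewrite inE => /subsetP; apply.
apply: eq_bigr => b bA.
rewrite [RHS](reindex_onto (fun C => b |: C) (fun B => B :\ b))/=; last first.
  by move=> B /andP[_ bB]; rewrite setD1K.
apply: eq_big => [C|C].
  rewrite !inE eqxx/= andbT; apply/idP/andP.
    move=> /subsetD1P[CA bC]; split; last by rewrite setU1K.
    by rewrite subUset sub1set bA.
  by move=> [bCA /eqP <-]; rewrite setSD.
by rewrite inE => /subsetD1P[_ bC]; rewrite setU1K.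
Qed.

(** The first tree of a nonempty forest is split off; B is its label set. The
    term of the empty set B vanishes. *)
Lemma forests1_rec A : A != set0 -> forests (fun=> 1) A =
  \sum_(B in powerset A) trees B * forests (fun=> 1) (A :\: B).
Proof.
move=> /forests_rec ->.
rewrite (exchange_subset _ (fun b C => 1 * forests (c b) C * forests _ (A :\ b :\: C))).
apply: eq_bigr => B; rewrite inE => BA; rewrite /trees mulr_suml; apply: eq_bigr => b bB.
rewrite mul1r; congr (_ * forests _ _); apply/setP => x; rewrite !inE.
by have [->|] := eqVneq x b; rewrite ?bB ?andbF//= andbT.
Qed.

(** A tree with more than one node is cut along the edge from its root a to its
    first child b. The result is an ordered pair of trees with complementary
    label sets, and the edge had weight c a b. Exchanging the two trees replaces
    this weight by c b a, so that twice the sum only involves the constant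
    value s of c a b + c b a. *)
Lemma trees_rec (s : R) A : (forall a b, a != b -> c a b + c b a = s) ->
  trees A *+ 2 = (#|A| == 1%N)%:R *+ 2 +
    s * \sum_(B in powerset A) trees B * trees (A :\: B).
Proof.
move=> cs.
(* b is the root of the tree on B, to be attached to the root a of the tree
   on D *)
pose h (B D : {set X}) := \sum_(b in B) \sum_(a in D)
  c a b * forests (c b) (B :\ b) * forests (c a) (D :\ a).
have E : trees A = (#|A| == 1%N)%:R + \sum_(B in powerset A) h B (A :\: B).
  have [/cards1P[a ->]|A1] := boolP (#|A| == 1%N).
    rewrite /trees big_set1 setDv forests0 big1 ?addr0// => B.
    rewrite inE subset1 => /orP[]/eqP->; rewrite /h.
      by rewrite big_set1 setDv big_set0.
    by rewrite big_set0.
  rewrite add0r /trees.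
  transitivity (\sum_(a in A) \sum_(b in A :\ a) \sum_(C in powerset (A :\ a :\ b))
      c a b * forests (c b) C * forests (c a) (A :\ a :\ b :\: C)).
    apply: eq_bigr => a aA; rewrite forests_rec//.
    by apply: contraNneq A1 => Aa; rewrite (cardsD1 a) aA Aa cards0.
  under eq_bigr => a aA do rewrite
    (exchange_subset _ (fun b C => c a b * forests (c b) C * forests (c a) (A :\ a :\ b :\: C))).
  rewrite (exchange_big_dep (mem (powerset A)))/=; last first.
    by move=> a B aA; rewrite !inE => /subset_trans; apply; exact: subD1set.
  apply: eq_bigr => B; rewrite inE => BA.
  rewrite /h [RHS]exchange_big/=; apply: eq_big => [a|a].
    by rewrite !inE andbC subsetD1 BA.
  rewrite !inE => /andP[aA /subsetD1P[_ aB]].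
  apply: eq_bigr => b bB; congr (_ * _ * forests _ _).
  apply/setP => x; rewrite !inE.
  by have [->|_] := eqVneq x b; rewrite ?bB; case: (_ == a); case: (_ \in B); case: (_ \in A).
(* exchange of the two trees *)
have E' : \sum_(B in powerset A) h B (A :\: B) = \sum_(B in powerset A) h (A :\: B) B.
  rewrite (reindex_onto (fun B => A :\: B) (fun B => A :\: B))/=; last first.
    by move=> B; rewrite inE => BA; rewrite setDDr setDv set0U (setIidPr BA).
  apply: eq_big => [B|B]; rewrite !inE.
    rewrite subsetDl/= setDDr setDv set0U; apply/eqP/idP => [<-|/setIidPr//].
    exact: subsetIl.
  by move=> /andP[_ /eqP->].
have E2 := E; rewrite E' in E2.
rewrite mulr2n {1}E E2 addrACA -mulr2n -big_split/=; congr (_ + _).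
rewrite mulr_sumr; apply: eq_bigr => B; rewrite inE => BA.
rewrite /h [X in _ + X]exchange_big/= -big_split/= /trees big_distrlr/= mulr_sumr.
apply: eq_bigr => b bB; rewrite mulr_sumr -big_split/=; apply: eq_bigr => a.
rewrite !inE => /andP[aB aA].
rewrite -(cs a b); last by apply: contraNneq aB => ->.
ring.
Qed.
End WeightedCount.
End Enumeration.

(** * The tree and forest coefficients *)

Section Numbers.
Variables (R : numFieldType) (s : R).
Local Open Scope ring_scope.

(** The power series S with S = z + (s / 2) S ^ 2: up to the factor
    (s / 2) ^ m, the coefficient of index m.+1 is the Catalan number of m. The
    product form follows from the differential equation
    (1 - 2 s z) S' = 1 - s S. *)
Definition tree_coef n : R :=
  if n is m.+1 then \prod_(j < m) (s * (2 * j%:R + 1) / (j%:R + 2)) else 0.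

Arguments tree_coef : simpl never.

Lemma tree_coef0 : tree_coef 0 = 0.
Proof. by []. Qed.

Lemma tree_coef1 : tree_coef 1 = 1.
Proof. by rewrite /tree_coef big_ord0. Qed.

Lemma tree_coefS n :
  n.+1%:R * tree_coef n.+1 = s * (2 * n%:R - 1) * tree_coef n + (n == 0)%:R.
Proof.
case: n => [|n]; first by rewrite tree_coef1 tree_coef0 /=; ring.
rewrite /tree_coef big_ord_recr/=; set P := \prod_(j < n) _.
have n2 : n%:R + 2 != 0 :> R by rewrite -natrD pnatr_eq0 addn2.
rewrite -[n.+2]addn2 -[n.+1]addn1 !natrD.
by field.
Qed.

Let conv n := \sum_(k < n.+1) tree_coef k * tree_coef (n - k).

Let conv_deriv n : n%:R * conv n =
  2 * \sum_(k < n.+1) k%:R * (tree_coef k * tree_coef (n - k)).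
Proof.
rewrite [RHS]mulr_natl mulr2n {2}(reindex_inj rev_ord_inj)/= -big_split/=.
rewrite /conv mulr_sumr; apply: eq_bigr => k _; rewrite subSS.
have kn : (k <= n)%N by rewrite -ltnS.
rewrite subKn// [tree_coef (n - k) * _]mulrC -mulrDl natrB//; congr (_ * _); ring.
Qed.

Let convS n : n.+1%:R * conv n.+1 = 2 * s * (n%:R - 1) * conv n + 2 * tree_coef n.
Proof.
rewrite conv_deriv big_ord_recl mul0r add0r.
transitivity (2 * \sum_(k < n.+1) (s * (2 * k%:R - 1) * tree_coef k + (k == 0 :> nat)%:R)
   * tree_coef (n - k)).
  congr (_ * _); apply: eq_bigr => k _.
  by rewrite -tree_coefS /= /bump/= add1n subSS mulrA.
under eq_bigr => k _.
  have -> : (s * (2 * k%:R - 1) * tree_coef k + (k == 0 :> nat)%:R) * tree_coef (n - k) =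
    s * 2 * (k%:R * (tree_coef k * tree_coef (n - k))) +
    - s * (tree_coef k * tree_coef (n - k)) + (k == 0 :> nat)%:R * tree_coef (n - k) by ring.
  over.
rewrite !big_split/= -!mulr_sumr -/(conv n).
rewrite [X in _ + X]big_ord_recl/= mul1r subn0.
rewrite [X in _ + (_ + X)]big1 ?addr0; last by move=> k _; rewrite mul0r.
have := conv_deriv n; set S := \sum_(_ < _) _ => e.
have -> : 2 * s * (n%:R - 1) * conv n = 2 * s * (n%:R * conv n) - 2 * s * conv n by ring.
by rewrite e; ring.
Qed.

(** The quadratic equation satisfied by the power series. The differential
    equation gives a linear recursion for its square as well, and both sides
    obey the same one. *)
Lemma tree_coef_conv n :
  s * \sum_(k < n.+1) tree_coef k * tree_coef (n - k) =
  tree_coef n *+ 2 - (n == 1%N)%:R *+ 2.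
Proof.
rewrite -/(conv n); elim: n => [|n IH].
  by rewrite /conv big_ord1 tree_coef0 /=; ring.
apply: (@mulfI _ n.+1%:R); first by rewrite pnatr_eq0.
rewrite mulrCA convS.
have -> : s * (2 * s * (n%:R - 1) * conv n + 2 * tree_coef n) =
  2 * s * (n%:R - 1) * (s * conv n) + 2 * s * tree_coef n by ring.
have -> : n.+1%:R * (tree_coef n.+1 *+ 2 - (n.+1 == 1)%:R *+ 2) =
  2 * (n.+1%:R * tree_coef n.+1) - 2 * (n.+1%:R * (n.+1 == 1)%:R) by ring.
rewrite IH tree_coefS; case: n {IH} => [|[|n]]; rewrite ?eqxx /=; ring.
Qed.

(** The coefficients of M = 1 / (1 - S). All the previous coefficients enter the
    recursion; fuel bounds the depth of the calls. *)
Fixpoint forest_coef_rec fuel n : R :=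
  if fuel is f.+1 then
    if n is m.+1 then
      \sum_(k < m.+1) tree_coef k.+1 * forest_coef_rec f (m - k)%N
    else 1
  else 1.

Definition forest_coef n := forest_coef_rec n n.

Lemma forest_coef0 : forest_coef 0 = 1.
Proof. by []. Qed.

Lemma forest_coefS n :
  forest_coef n.+1 = \sum_(k < n.+1) tree_coef k.+1 * forest_coef (n - k).
Proof.
have fuel f g m : (m <= f)%N -> (m <= g)%N -> forest_coef_rec f m = forest_coef_rec g m.
  elim: f g m => [|f IH] [|g] [|m]//= mf mg; apply: eq_bigr => k _.
  by congr (_ * _); apply: IH; rewrite (leq_trans (leq_subr _ _)).
rewrite /forest_coef /=; apply: eq_bigr => k _; congr (_ * _); apply: fuel => //.
exact: leq_subr.
Qed.

(** The identity (2 - s - 2 z) M = 2 - s - s S of power series: the product of the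
    right-hand side by 1 - S is 2 - s - 2 z, by the quadratic equation for
    S. *)
Lemma forest_coef_rec2 n :
  (2 - s) * forest_coef n.+1 = 2 * forest_coef n - s * tree_coef n.+1.
Proof.
elim/ltn_ind: n => -[|n] IH.
  rewrite forest_coefS big_ord1 forest_coef0 tree_coef1; ring.
rewrite forest_coefS big_ord_recr/= subnn forest_coef0 mulrDr mulr_sumr.
rewrite (eq_bigr (fun k : 'I_n.+1 => 2 * (tree_coef k.+1 * forest_coef (n - k)) -
    s * (tree_coef k.+1 * tree_coef (n.+1 - k)))); last first.
  move=> k _; have kn : (k <= n)%N by rewrite -ltnS.
  rewrite subSn// mulrCA IH ?ltnS ?leq_subr//. ring.
rewrite sumrB -!mulr_sumr -forest_coefS.
have := tree_coef_conv n.+2.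
rewrite big_ord_recl big_ord_recr/= subnn tree_coef0 mul0r mulr0 addr0 add0r.
by move=> e; rewrite [X in _ - X + _]e; ring.
Qed.
End Numbers.
Arguments tree_coef {R} s n : simpl never.

Section CountByCardinality.
Variables (R : numFieldType) (X : finType).
Implicit Types (A B : {set X}).
Local Open Scope ring_scope.

Lemma sum_powerset_card A (g : nat -> R) :
  \sum_(B in powerset A) g #|B| = \sum_(k < #|A|.+1) 'C(#|A|, k)%:R * g k.
Proof.
rewrite (partition_big (fun B => inord #|B| : 'I_(#|A|.+1)) xpredT)//=.
apply: eq_bigr => k _.
have -> : 'C(#|A|, k)%:R = \sum_(B | B \in [set B : {set X} | (B \subset A) & #|B| == k]) 1 :> R.
  by rewrite -cards_draws -sum1_card natr_sum.
rewrite mulr_suml; apply: eq_big => B; last first.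
  rewrite inE => /andP[BA /eqP <-]; rewrite mul1r inordK// ltnS.
  exact: subset_leq_card.
rewrite !inE; case: (boolP (B \subset A)) => //= BA.
by rewrite -val_eqE/= inordK// ltnS; exact: subset_leq_card.
Qed.

(** Sums over complementary subsets correspond to products of exponential
    generating series. *)
Lemma sum_powerset_fact A (g h : nat -> R) :
  \sum_(B in powerset A) (#|B|`!%:R * g #|B|) * (#|A :\: B|`!%:R * h #|A :\: B|) =
  #|A|`!%:R * \sum_(k < #|A|.+1) g k * h (#|A| - k)%N.
Proof.
transitivity (\sum_(B in powerset A)
   (fun k => (k`!%:R * g k) * ((#|A| - k)`!%:R * h (#|A| - k)%N)) #|B|).
  by apply: eq_bigr => B; rewrite inE => BA; rewrite cardsD (setIidPr BA).
rewrite (sum_powerset_card A (fun k => (k`!%:R * g k) * ((#|A| - k)`!%:R * h (#|A| - k)%N))).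
rewrite mulr_sumr; apply: eq_bigr => k _.
have kA : (k <= #|A|)%N by rewrite -ltnS.
rewrite -(bin_fact kA) !natrM; ring.
Qed.

Variables (s : R) (c : X -> X -> R).
Hypothesis cs : forall a b, a != b -> c a b + c b a = s.

(** The recursion [trees_rec] determines the weights of trees by induction on
    the size of the alphabet, because the weight of the empty alphabet is zero;
    its solution is the coefficient sequence of S. *)
Lemma trees_card A : trees c A = #|A|`!%:R * tree_coef s #|A|.
Proof.
have [m] := ubnP #|A|; elim: m A => // m IH A Am.
have t0 : trees c set0 = 0 by rewrite /trees big_set0.
apply: (@mulIf _ 2); rewrite ?pnatr_eq0// !mulr_natr (trees_rec _ cs).
rewrite (eq_bigr (fun B => (#|B|`!%:R * tree_coef s #|B|) *
   (#|A :\: B|`!%:R * tree_coef s #|A :\: B|))); last first.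
  move=> B; rewrite inE => BA.
  have [->|B0] := eqVneq B set0; first by rewrite t0 cards0 tree_coef0 mulr0 !mul0r.
  have [->|BneA] := eqVneq B A; first by rewrite setDv t0 cards0 tree_coef0 !mulr0.
  have c1 : (#|B| < #|A|)%N by rewrite proper_card// properEneq BneA.
  have c2 : (#|A :\: B| < #|A|)%N.
    by rewrite cardsD (setIidPr BA); rewrite -card_gt0 in B0; lia.
  by rewrite !IH// -ltnS (leq_trans _ Am).
rewrite sum_powerset_fact mulrCA tree_coef_conv.
have f1 : 1`!%:R = 1 :> R by [].
case: eqVneq => [->|_]; first by rewrite tree_coef1 f1 /=; ring.
by rewrite /=; ring.
Qed.

Lemma forests_card A :
  forests c (fun=> 1) A = #|A|`!%:R * forest_coef s #|A|.
Proof.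
have [m] := ubnP #|A|; elim: m A => // m IH A Am.
have [->|A0] := eqVneq A set0.
  by rewrite forests0 cards0 mulr1.
have t0 : trees c set0 = 0 by rewrite /trees big_set0.
rewrite forests1_rec//.
rewrite (eq_bigr (fun B => (#|B|`!%:R * tree_coef s #|B|) *
   (#|A :\: B|`!%:R * forest_coef s #|A :\: B|))); last first.
  move=> B; rewrite inE => BA; rewrite -trees_card.
  have [->|B0] := eqVneq B set0; first by rewrite t0 !mul0r.
  rewrite IH//.
  rewrite cardsD (setIidPr BA); rewrite -card_gt0 in B0.
  have := subset_leq_card BA; lia.
rewrite sum_powerset_fact; congr (_ * _).
have [n ->] : exists n, #|A| = n.+1.
  by case: #|A| (cards_eq0 A) => [|n _]; [rewrite (negbTE A0)|exists n].
by rewrite big_ord_recl tree_coef0 mul0r add0r forest_coefS.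
Qed.
End CountByCardinality.

(** * Ordered noncrossing pair partitions as words *)

Lemma exists_in_set2 (T : finType) (a b : T) (Q : pred T) :
  [exists x in [set a; b], Q x] = Q a || Q b.
Proof.
apply/exists_inP/orP => [[x]|[Qx|Qx]]; last 2 first.
- by exists a; rewrite ?inE ?eqxx.
- by exists b; rewrite ?inE ?eqxx ?orbT.
by rewrite !inE => /orP[]/eqP-> ->; [left|right].
Qed.

Lemma forall_in_set2 (T : finType) (a b : T) (Q : pred T) :
  [forall x in [set a; b], Q x] = Q a && Q b.
Proof.
apply/forall_inP/andP => [h|[Qa Qb] x]; first by rewrite !h// !inE eqxx ?orbT.
by rewrite !inE => /orP[]/eqP->.
Qed.

Section PairBlocks.
Variable n : nat.
Implicit Types (a b c d : 'I_n) (B C : {set 'I_n}).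

Variables (X : finType) (w : n.-tuple X).

Definition letter_block i : {set 'I_n} := [set x | tnth w x == i].

Lemma card_letter_block i : #|letter_block i| = count_mem i w.
Proof.
rewrite -[in RHS](map_tnth_enum w) count_map.
rewrite -sum1_card -sum1_count big_enum_cond /=.
by apply: eq_bigl => x; rewrite !inE.
Qed.

(** The four positions of the two letters form an increasing list, labelled in
    one of six ways; in each case both sides are decided by the order of the
    four positions. *)
Lemma restriction_letter_block i j : i != j ->
  count_mem i w = 2 -> count_mem j w = 2 ->
  outer (letter_block i) (letter_block j) = nested w i j /\
  crossing (letter_block i) (letter_block j) = (restriction i j w == [:: i; j; i; j]).
Proof.
move=> ij ci cj.
pose s := [seq x <- enum 'I_n | (tnth w x == i) || (tnth w x == j)].
have ts : restriction i j w = map (tnth w) s.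
  by rewrite /restriction -{1}(map_tnth_enum w) filter_map.
have ms x : (x \in s) = (tnth w x == i) || (tnth w x == j).
  by rewrite mem_filter mem_enum andbT.
have sz : size s = 4.
  rewrite -(size_map (tnth w)) -ts /restriction size_filter.
  have := count_predUI (pred1 i) (pred1 j) w; rewrite ci cj.
  rewrite (@eq_count _ (predI _ _) pred0) ?count_pred0 ?addn0//.
  by move=> x /=; apply/negP => /andP[/eqP->]; apply/negP.
have ss : sorted (relpre val ltn) s.
  apply: sorted_filter; first by move=> y x z; exact: ltn_trans.
  by rewrite -sorted_map val_enum_ord iota_ltn_sorted.
have bs k : (k == i) || (k == j) -> letter_block k = [set x in s | tnth w x == k].
  move=> kij; apply/setP => x; rewrite !inE ms.
  by case: eqP => [->|]; rewrite ?andbF// kij.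
rewrite (bs i) ?eqxx// (bs j) ?eqxx ?orbT// /nested ts.
have cs k : (k == i) || (k == j) -> count (fun x => tnth w x == k) s = 2.
  move=> kij; transitivity (count_mem k (restriction i j w)).
    by rewrite ts count_map.
  rewrite count_filter; transitivity (count_mem k w).
    by apply: eq_count => z /=; case: eqP => [->|].
  by case/orP: kij => /eqP->.
have := cs i; have := cs j; rewrite !eqxx orbT => /(_ isT) + /(_ isT).
move: ms ss sz; rewrite {ts bs cs}; case: s => [|x1 [|x2 [|x3 [|x4 [|]]]]] //.
move=> ms /= /and4P[l12 l23 l34 _] _.
have := ms x1; have := ms x2; have := ms x3; have := ms x4.
rewrite !inE !eqxx ?orbT /=.
have ji : (j == i) = false by rewrite eq_sym (negbTE ij).
pose simpl := (eqxx, ji, negbTE ij).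
pose pt k x : {set 'I_n} := if tnth w x == k then [set x] else set0.
have mk k : [set x in [:: x1; x2; x3; x4] | tnth w x == k] =
   pt k x1 :|: pt k x2 :|: pt k x3 :|: pt k x4.
  apply/setP => x; have e y : (x \in pt k y) = (x == y) && (tnth w x == k).
    rewrite /pt; have [->|xy] := eqVneq x y; first by case: ifP; rewrite !inE ?eqxx.
    by case: ifP => _; rewrite !inE// (negbTE xy).
  by rewrite !inE !e -!andb_orl !orbA.
rewrite !mk /pt {mk pt}.
have ne (a b c d : 'I_n) : a != c -> a != d -> [set a; b] != [set c; d].
  move=> ac ad; apply/eqP => /setP/(_ a).
  by rewrite !inE eqxx (negbTE ac) (negbTE ad).
have l13 := ltn_trans l12 l23; have l24 := ltn_trans l23 l34.
have l14 := ltn_trans l13 l34.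
have ge k l : k < l -> (l < k) = false by move=> kl; rewrite ltnNge ltnW.
pose lt := (l12, l13, l14, l23, l24, l34,
  (ge _ _ l12, ge _ _ l13, ge _ _ l14, ge _ _ l23, ge _ _ l24, ge _ _ l34), ltnn).
do 4!(move=> /esym/orP[]/eqP->); rewrite ?simpl //= => _ _;
  rewrite ?set0U ?setU0 !eqseq_cons ?simpl /= /outer /crossing ne /=
          -?val_eqE /= ?exists_in_set2 ?forall_in_set2 /= ?lt ?neq_ltn ?lt //.
Qed.
End PairBlocks.

Section BlocksOfWord.
Variables (n k : nat) (w : n.-tuple 'I_k).

Definition letter_blocks : k.-tuple {set 'I_n} := [tuple letter_block w i | i < k].

Lemma mem_letter_blocks B :
  reflect (exists i, B = letter_block w i) (B \in letter_blocks).
Proof.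
apply: (iffP (tnthP _ _)) => -[i e]; exists i.
  by rewrite e /letter_blocks tnth_mktuple.
by rewrite e /letter_blocks tnth_mktuple.
Qed.

Lemma letter_block_neq i j : i != j -> letter_block w i != set0 ->
  letter_block w i != letter_block w j.
Proof.
move=> ij /set0Pn[x]; rewrite inE => /eqP xi.
by apply/eqP => /setP/(_ x); rewrite !inE xi eqxx (negbTE ij).
Qed.

Lemma ordered_noncrossing_letter_blocks :
  ordered_noncrossing_pair letter_blocks = pairing setT w.
Proof.
apply/idP/idP.
  case/andP => /and3P[_ _ /forall_inP nc] /allP c2.
  have {}c2 i : count_mem i w = 2.
    by rewrite -card_letter_block; apply/eqP/c2/mem_letter_blocks; exists i.
  apply/andP; split; apply/forallP => i; first by rewrite inE c2.
  apply/forallP => j; apply/implyP => ij.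
  have /nc/forall_inP : letter_block w i \in [set:: letter_blocks].
    by rewrite inE; apply/mem_letter_blocks; exists i.
  move=> /(_ (letter_block w j)); rewrite inE => /(_ _)/implyP => h.
  have [_ <-] := restriction_letter_block ij (c2 i) (c2 j).
  apply: h; first by apply/mem_letter_blocks; exists j.
  by apply: letter_block_neq => //; rewrite -cards_eq0 card_letter_block c2.
move=> pw; have c2 i : count_mem i w = 2 by rewrite (pairing_count _ pw) inE.
have bn0 i : letter_block w i != set0 by rewrite -cards_eq0 card_letter_block c2.
apply/andP; split; last first.
  by apply/allP => B /mem_letter_blocks[i ->]; rewrite card_letter_block c2.
apply/and3P; split.
- rewrite /= map_inj_uniq ?enum_uniq// => i j e.
  by apply/eqP; apply: contraT => ij; have := letter_block_neq ij (bn0 i); rewrite e eqxx.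
- apply/and3P; split.
  + apply/eqP/setP => x; rewrite inE; apply/bigcupP; exists (letter_block w (tnth w x)).
      by rewrite inE; apply/mem_letter_blocks; eexists.
    by rewrite inE.
  + apply/trivIsetP => _ _ /[!inE] /mem_letter_blocks[i ->] /mem_letter_blocks[j ->] ne.
    rewrite -setI_eq0; apply/eqP/setP => x; rewrite !inE; apply/negP => /andP[/eqP ei /eqP ej].
    by rewrite -ei -ej eqxx in ne.
  + by rewrite inE; apply/mem_letter_blocks => -[i e]; have := bn0 i; rewrite -e eqxx.
apply/forall_inP => _ /[!inE] /mem_letter_blocks[i ->].
apply/forall_inP => _ /[!inE] /mem_letter_blocks[j ->].
apply/implyP => ne.
have ij : i != j by apply: contraNneq ne => ->.
have [_ ->] := restriction_letter_block ij (c2 i) (c2 j).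
by case/andP: pw => _ /forallP/(_ i)/forallP/(_ j)/implyP; apply.
Qed.

Section Weight.
Hypothesis pw : pairing setT w.

Lemma outer_letter_block i j :
  outer (letter_block w i) (letter_block w j) = nested w i j.
Proof.
have c2 l : count_mem l w = 2 by rewrite (pairing_count _ pw) inE.
have [<-|ij] := eqVneq i j; last by have [] := restriction_letter_block ij (c2 i) (c2 j).
rewrite /outer eqxx; apply/esym/negbTE; rewrite /nested; apply/eqP => /(congr1 size)/=.
rewrite size_filter (@eq_count _ _ (pred1 i)) ?c2// => z /=; by rewrite orbb.
Qed.

Lemma directly_outer_letter_block i j :
  directly_outer [set:: letter_blocks] (letter_block w i) (letter_block w j) =
  directly_nested w i j.
Proof.
rewrite /directly_outer /directly_nested outer_letter_block; congr (_ && ~~ _).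
apply/exists_inP/existsP => [[D]|[z]].
  rewrite inE => /mem_letter_blocks[z ->]; rewrite !outer_letter_block => h.
  by exists z.
rewrite -!outer_letter_block => h; exists (letter_block w z) => //.
by rewrite inE; apply/mem_letter_blocks; exists z.
Qed.

(** A pair of indices in increasing order is a disorder when the second block is
    the parent of the first one, and an order when it is the other way round;
    every edge of the forest is counted exactly once. *)
Lemma weight_letter_blocks (R : comNzRingType) (p q : R) :
  (p ^+ disorders letter_blocks * q ^+ orders letter_blocks =
   forest_weight (fun i j : 'I_k => if (j < i)%N then p else q) (fun=> 1) w)%R.
Proof.
have D (i j : 'I_k) : directly_outer [set:: letter_blocks]
    (nth set0 letter_blocks i) (nth set0 letter_blocks j) = directly_nested w i j.
  by rewrite -!tnth_nth !tnth_mktuple directly_outer_letter_block.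
have cast m (Q : rel nat) : m = k ->
    #|[set ij : 'I_m * 'I_m | Q ij.1 ij.2]| = #|[set ij : 'I_k * 'I_k | Q ij.1 ij.2]|.
  by move=> ->.
pose Q i j := directly_outer [set:: letter_blocks]
  (nth set0 letter_blocks i) (nth set0 letter_blocks j).
have -> : disorders letter_blocks =
    #|[set ij : 'I_k * 'I_k | (ij.1 < ij.2) && directly_nested w ij.2 ij.1]|.
  rewrite [LHS](cast _ (fun i j => (i < j) && Q j i)) ?size_tuple//.
  by apply: eq_card => -[i j]; rewrite !inE /Q D.
have -> : orders letter_blocks =
    #|[set ij : 'I_k * 'I_k | (ij.1 < ij.2) && directly_nested w ij.1 ij.2]|.
  rewrite [LHS](cast _ (fun i j => (i < j) && Q i j)) ?size_tuple//.
  by apply: eq_card => -[i j]; rewrite !inE /Q D.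
rewrite /forest_weight [X in (_ = _ * X)%R]big1 ?mulr1// pair_big_dep/=.
rewrite (bigID (fun ij : 'I_k * 'I_k => ij.2 < ij.1))/= -!prodr_const; congr (_ * _)%R.
  rewrite (reindex_inj (h := fun ij : 'I_k * 'I_k => (ij.2, ij.1)))/=; last first.
    by move=> [i j] [i' j'] [-> ->].
  apply: eq_big => [ij|ij]; first by rewrite inE andbC.
  by rewrite inE => /andP[-> _].
apply: eq_big => [[i j]|[i j]]; rewrite inE /=; last first.
  by move=> /andP[ij _]; rewrite ltnNge ltnW.
case: (boolP (directly_nested w i j)) => c; rewrite ?andbF// andbT /= -leqNgt ltn_neqAle.
have [ij|ij] := eqVneq (i : 'I_k) j; last by rewrite (ij : nat_of_ord i != j).
by move: c; rewrite ij /directly_nested -outer_letter_block /outer eqxx.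
Qed.
End Weight.
End BlocksOfWord.

(** The block sequences correspond to the words through the map that sends a
    position to the index of its block; n is positive so that there is an index
    to serve as default value for that map. *)
Lemma sum_ordered_noncrossing_pair (R : numFieldType) (p q : R) n : 0 < n ->
  (\sum_(P : n.-tuple {set 'I_(n.*2)} | ordered_noncrossing_pair P)
     p ^+ disorders P * q ^+ orders P = n`!%:R * forest_coef (p + q) n)%R.
Proof.
case: n => // m _; set n := m.+1.
pose word_of (P : n.-tuple {set 'I_(n.*2)}) : n.*2.-tuple 'I_n :=
  [tuple odflt ord0 [pick i | x \in tnth P i] | x < n.*2].
rewrite (reindex_onto (fun w => letter_blocks w) word_of)/=; last first.
  move=> P /andP[/and3P[uP /and3P[/eqP cP tP P0] _] _].
  have mP i : tnth P i \in [set:: P] by rewrite inE mem_tnth.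
  apply: eq_from_tnth => i; rewrite tnth_mktuple; apply/setP => x; rewrite inE tnth_mktuple.
  have : x \in cover [set:: P] by rewrite cP inE.
  case/bigcupP => B; rewrite inE => /tnthP[j ->] xj.
  have tE l : x \in tnth P l -> l = j.
    move=> xl; apply/eqP; apply: contraT => lj.
    have : tnth P l != tnth P j.
      by apply: contraNneq lj => /(tuple_uniqP _ uP) ->.
    move=> /(trivIsetP tP _ _ (mP l) (mP j)).
    by rewrite -setI_eq0 => /eqP/setP/(_ x); rewrite !inE xl xj.
  case: pickP => [l xl|/(_ j)]; last by rewrite xj.
  by apply/eqP/idP => [<-//|xi]; rewrite (tE _ xl) (tE _ xi).
pose c (i j : 'I_n) := (if (j < i)%N then p else q)%R.
transitivity (\sum_(w : n.*2.-tuple 'I_n | pairing setT w) forest_weight c (fun=> 1) w)%R.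
  apply: eq_big => [w|w /andP[ow _]]; last first.
    by rewrite weight_letter_blocks// -ordered_noncrossing_letter_blocks.
  rewrite ordered_noncrossing_letter_blocks andb_idr// => _; apply/eqP.
  apply: eq_from_tnth => x; rewrite tnth_mktuple; case: pickP => [i|/(_ (tnth w x))].
    by rewrite tnth_mktuple inE => /eqP.
  by rewrite tnth_mktuple inE eqxx.
have cpq a b : a != b -> (c a b + c b a = p + q)%R.
  by rewrite /c -val_eqE neq_ltn => /orP[] ab; rewrite ab ltnNge ltnW//= addrC.
have := forests_card cpq setT; rewrite cardsT card_ord => <-.
rewrite /forests; under [RHS]eq_bigl do rewrite /=.
rewrite -(big_map val (pairing setT) (forest_weight c (fun=> 1)%R)) -big_filter.
apply: perm_big; apply: uniq_perm.
- by rewrite filter_uniq// map_inj_uniq ?index_enum_uniq//; exact: val_inj.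
- exact: words_uniq.
move=> w; rewrite mem_filter; apply/andP/idP.
  by move=> [/pairing_words + _]; apply.
move=> /words_pairing pw; split=> //.
have sw : size w == n.*2.
  have -> : size w = \sum_(i : 'I_n) count_mem i w.
    rewrite -sum1_size (partition_big id xpredT)//=.
    by apply: eq_bigr => i _; rewrite sum1_count; apply: eq_count => x.
  under eq_bigr => i _ do rewrite (pairing_count _ pw) inE.
  by rewrite sum_nat_const card_ord muln2.
by apply/mapP; exists (Tuple sw) => //; rewrite mem_index_enum.
Qed.

(* The analytic notations come last: those for sets would shadow the notations
   for finite sets used above. *)
From mathcomp Require Import all_classical all_reals all_analysis.
From mathcomp Require Import measurable_realfun.
Import Order.TTheory GRing.Theory Num.Theory.
Import numFieldNormedType.Exports.
Local Open Scope classical_set_scope.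
Local Open Scope ring_scope.

(** * Polynomials approximating the indicator of a half-line *)

Section StepPolynomials.
Variable R : realType.
Implicit Types (x y : R).

Lemma bernoulli_ge x n : -1 <= x -> 1 + x *+ n <= (1 + x) ^+ n.
Proof.
move=> x1; have x10 : 0 <= 1 + x by rewrite -lerBlDl sub0r.
elim: n => [|n IH]; first by rewrite mulr0n addr0 expr0.
rewrite exprS (le_trans _ (ler_wpM2l x10 IH))//.
have : 0 <= x ^+ 2 * n%:R by rewrite mulr_ge0// sqr_ge0.
rewrite mulrS -(mulr_natr x n); move: n%:R => r; nra.
Qed.

(** With y the square root of x, the term is (n y ^ n) y ^ n, whose first factor
    is bounded by the Bernoulli inequality. *)
Lemma cvg_natmul_exp x : 0 <= x < 1 -> (x ^+ n *+ n) @[n --> \oo] --> (0 : R).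
Proof.
move=> /andP[x0 x1].
have [->|xn0] := eqVneq x 0.
  apply: cvg_near_cst; near=> n; rewrite expr0n.
  have /negbTE -> : n != 0%N by rewrite -lt0n; near: n; exact: nbhs_infty_gt.
  by rewrite mul0rn.
have {}x0 : 0 < x by rewrite lt_neqAle eq_sym xn0.
pose y := Num.sqrt x.
have y0 : 0 < y by rewrite sqrtr_gt0.
have y1 : y < 1 by rewrite -sqrtr1 ltr_sqrt.
have yx : y ^+ 2 = x by rewrite sqr_sqrtr// ltW.
pose h := y^-1 - 1.
have h0 : 0 < h by rewrite subr_gt0 invf_gt1.
have hn n : y ^+ n *+ n <= h^-1.
  have : 1 + h *+ n <= (1 + h) ^+ n by apply: bernoulli_ge; lra.
  rewrite (_ : 1 + h = y^-1) ?exprVn => [H|]; last by rewrite /h addrC subrK.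
  rewrite -mulr_natr -ler_pdivlMl ?exprn_gt0// ler_pdivlMr// mulrC mulr_natr.
  by apply: le_trans H; rewrite lerDr.
apply: (@squeeze_cvgr _ _ _ _ (cst 0) (fun n => h^-1 * y ^+ n)).
- near=> n; apply/andP; split; first by rewrite /= mulrn_wge0// exprn_ge0// ltW.
  have -> : x ^+ n *+ n = (y ^+ n *+ n) * y ^+ n.
    by rewrite -yx -exprM mulnC exprM expr2 mulrnAl.
  by apply: ler_wpM2r => //; rewrite exprn_ge0// ltW.
- exact: cvg_cst.
- rewrite -(mulr0 h^-1); apply: cvgMl_tmp; apply: cvg_expr.
  by rewrite gtr0_norm.
Unshelve. all: by end_near. Qed.

(** Without the factor n in the exponent, the limit at y = 1 / 2 would be the
    inverse of e. This factor grows slowly enough not to disturb the limit 1 for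
    y < 1 / 2, and makes the limit at 1 / 2 equal to 0, so that possible atoms of
    the measures need no separate treatment. *)
Definition step_poly n y := (1 - y ^+ n) ^+ (n * 2 ^ n).

Lemma step_poly_itv n y : 0 <= y <= 1 -> 0 <= step_poly n y <= 1.
Proof.
move=> /andP[y0 y1]; have := exprn_ge0 n y0; have := exprn_ile1 n y0 y1.
move=> h1 h0; rewrite /step_poly exprn_ge0 ?subr_ge0//=.
by rewrite exprn_ile1 ?subr_ge0// lerBlDr lerDl.
Qed.

(** Both bounds come from the Bernoulli inequality: below 1 / 2 the value is at
    least 1 - n (2 y) ^ n, and above it is at most the inverse of
    (1 + y ^ n) ^ (n 2 ^ n), which is at least 1 + n. *)
Lemma cvg_step_poly y : 0 <= y <= 1 ->
  step_poly n y @[n --> \oo] --> (if y < 2^-1 then 1 else 0 : R).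
Proof.
move=> /andP[y0 y1]; case: ltP => y2.
  apply: (@squeeze_cvgr _ _ _ _ (fun n => 1 - (2 * y) ^+ n *+ n) (cst 1)).
  - near=> n; have /andP[_ ->] : 0 <= step_poly n y <= 1 by apply: step_poly_itv; rewrite y0.
    rewrite andbT; have := @bernoulli_ge (- y ^+ n) (n * 2 ^ n).
    have := exprn_ile1 n y0 y1 => yn1; rewrite lerN2 => /(_ yn1).
    have -> : (2 * y) ^+ n *+ n = y ^+ n *+ (n * 2 ^ n).
      by rewrite exprMn mulnC mulrnA -natrX mulr_natl.
    by rewrite mulNrn.
  - rewrite -[X in _ --> X]subr0; apply: cvgB; first exact: cvg_cst.
    by apply: cvg_natmul_exp; apply/andP; split; lra.
  - exact: cvg_cst.
apply: (@squeeze_cvgr _ _ _ _ (cst 0) (fun n => n.+1%:R^-1)).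
- near=> n; have /andP[-> _] : 0 <= step_poly n y <= 1 by apply: step_poly_itv; rewrite y0.
  rewrite /= -div1r ler_pdivlMr//.
  have y2' : 1 <= 2 * y by lra.
  have yn1 := exprn_ile1 n y0 y1; have yn0 := exprn_ge0 n y0.
  have b : n.+1%:R <= (1 + y ^+ n) ^+ (n * 2 ^ n).
    apply: (le_trans _ (bernoulli_ge _ _)); last by rewrite (le_trans _ yn0)// lerN10.
    rewrite -natr1 addrC lerD2l -(mulr_natr (y ^+ n)) natrM mulrCA ler_peMr//.
    by rewrite mulrC natrX -exprMn exprn_ege1.
  rewrite (le_trans (ler_wpM2l _ b))//.
    by rewrite exprn_ge0// subr_ge0.
  rewrite /step_poly -exprMn -subr_sqr expr1n exprn_ile1//.
    by rewrite subr_ge0 exprn_ile1.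
  by rewrite lerBlDr lerDl sqr_ge0.
- exact: cvg_cst.
- exact: cvg_harmonic.
Unshelve. all: by end_near. Qed.

End StepPolynomials.

(** * Compactly supported probability measures are determined by their moments *)

Section MomentDeterminacy.
Variable R : realType.
Local Notation T := (measurableTypeR R).
Implicit Types (mu nu : probability T R) (p : {poly R}) (L t : R).

Local Notation integrable_moments mu :=
  (forall n, mu.-integrable setT (fun x : T => (x ^+ n)%:E)).

Lemma integrable_horner mu p : integrable_moments mu ->
  mu.-integrable setT (fun x : T => (p.[x])%:E).
Proof.
move=> im.
suff : forall k, mu.-integrable setT (fun x : T => (x ^+ k * p.[x])%:E).
  by move=> /(_ 0%N); apply: eq_integrable => // x _; rewrite expr0 mul1r.
elim/poly_ind: p => [|p c IH] k.
  apply: (eq_integrable _ (cst 0%E)) => //; last exact: integrable0.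
  by move=> x _; rewrite horner0 mulr0.
have := integrableD measurableT (IH k.+1) (integrableZl measurableT c (im k)).
apply: eq_integrable => // x _; rewrite !hornerE /= -EFinM -EFinD; congr EFin.
by rewrite exprSr; ring.
Qed.

Lemma integral_horner_eq mu nu p : integrable_moments mu -> integrable_moments nu ->
  (forall n, \int[mu]_x (x ^+ n)%:E = \int[nu]_x (x ^+ n)%:E)%E ->
  (\int[mu]_x (p.[x])%:E = \int[nu]_x (p.[x])%:E)%E.
Proof.
move=> imu inu e.
suff : forall k, (\int[mu]_x (x ^+ k * p.[x])%:E = \int[nu]_x (x ^+ k * p.[x])%:E)%E.
  move=> /(_ 0%N); under eq_integral do rewrite expr0 mul1r.
  by under [in X in _ = X -> _]eq_integral do rewrite expr0 mul1r.
have ip (m : probability T R) (q : {poly R}) k : integrable_moments m ->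
    m.-integrable setT (fun x : T => (x ^+ k * q.[x])%:E).
  move=> im; have := integrable_horner ('X^k * q) im.
  by apply: eq_integrable => // x _; rewrite !hornerE.
elim/poly_ind: p => [|p c IH] k.
  under eq_integral do rewrite horner0 mulr0.
  by under [RHS]eq_integral do rewrite horner0 mulr0; rewrite !integral0.
have E (m : probability T R) : integrable_moments m ->
  (\int[m]_x (x ^+ k * (p * 'X + c%:P).[x])%:E =
   \int[m]_x (x ^+ k.+1 * p.[x])%:E + c%:E * \int[m]_x (x ^+ k)%:E)%E.
  move=> im; rewrite -(integralZl measurableT (im k)) -integralD//; last 2 first.
  - exact: ip.
  - exact: integrableZl.
  apply: eq_integral => x _; rewrite !hornerE /= -EFinM -EFinD; congr EFin.
  by rewrite exprSr; ring.
by rewrite !E// IH e.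
Qed.

Lemma even_moment_le mu L k : 0 <= L -> mu (~` `[- L, L]) = 0%E ->
  (\int[mu]_x (x ^+ k.*2)%:E <= (L ^+ k.*2)%:E)%E.
Proof.
move=> L0; set D := [set` _] => mL; have mD : measurable D by exact: measurable_itv.
have ev (x : R) : 0 <= x ^+ k.*2 by rewrite -mul2n exprM exprn_ge0// sqr_ge0.
have mX (A : set T) : measurable_fun A (fun x : T => (x ^+ k.*2)%:E).
  by apply/measurable_EFinP; exact: exprn_measurable.
have -> : (\int[mu]_x (x ^+ k.*2)%:E = \int[mu]_(x in D) (x ^+ k.*2)%:E)%E.
  rewrite [LHS](@ge0_negligible_integral _ _ _ mu setT (~` D))//.
  - by rewrite setTD setCK.
  - exact: measurableC.
  - by move=> x _; rewrite lee_fin.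
apply: (@le_trans _ _ (\int[mu]_(x in D) (cst (L ^+ k.*2)%:E x))%E); last first.
  rewrite integral_cst//= -[leRHS]mule1 lee_wpmul2l ?lee_fin// ?exprn_ge0//.
  exact: probability_le1.
apply: ge0_le_integral => //.
- by move=> x _; rewrite lee_fin.
- move=> x; rewrite /D /= in_itv/= => xL; rewrite lee_fin -(ger0_norm (ev x)) normrX.
  by rewrite lerXn2r ?nnegrE// ler_norml.
Qed.

(** On the complement of [-2 L, 2 L] the integrand is at least
    (2 L) ^ (2 k), so that this set has measure at most 4 ^ -k for all k. The
    factor 2 could be any number greater than 1. *)
Lemma tail_of_moments nu L : 0 < L ->
  (forall k, \int[nu]_x (x ^+ k.*2)%:E <= (L ^+ k.*2)%:E)%E ->
  nu (~` `[- (L *+ 2), L *+ 2]) = 0%E.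
Proof.
move=> L0 h; set D := ~` _; have mD : measurable D by apply: measurableC; exact: measurable_itv.
have ev k (x : R) : 0 <= x ^+ k.*2 by rewrite -mul2n exprM exprn_ge0// sqr_ge0.
have key k : (nu D <= (4^-1 ^+ k)%:E)%E.
  have : (((L *+ 2) ^+ k.*2)%:E * nu D <= (L ^+ k.*2)%:E)%E.
    apply: le_trans (h k); rewrite -integral_cst//.
    apply: (@le_trans _ _ (\int[nu]_(x in D) (x ^+ k.*2)%:E)%E).
      apply: ge0_le_integral => //.
      - by move=> x _; rewrite lee_fin.
      - by apply/measurable_EFinP; exact: exprn_measurable.
      - move=> x /= xD; rewrite lee_fin -(ger0_norm (ev k x)) normrX.
        rewrite lerXn2r ?nnegrE ?mulrn_wge0// 1?ltW//.
        by move: xD => /negP; rewrite in_itv/= -ler_norml -ltNge.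
    apply: ge0_subset_integral => //.
    - by apply/measurable_EFinP; exact: exprn_measurable.
    - by move=> x _; rewrite lee_fin.
  have fD : nu D \is a fin_num by exact: fin_num_measure.
  rewrite -(fineK fD) -EFinM !lee_fin -(mulr_natl L 2) exprMn mulrAC -[leRHS]mul1r.
  rewrite ler_pM2r ?exprn_gt0// -mul2n exprM => H.
  rewrite exprVn -div1r ler_pdivlMr ?exprn_gt0// [X in X <= _]mulrC.
  by rewrite (_ : 4 = 2 ^+ 2) //; ring.
apply/eqP; rewrite eq_le measure_ge0 andbT.
have fD : nu D \is a fin_num by exact: fin_num_measure.
rewrite -(fineK fD) lee_fin.
apply: (@ler_cvg_to _ \oo _ _ (cst (fine (nu D))) (fun k => 4^-1 ^+ k)).
- exact: cvg_cst.
- by apply: cvg_expr; rewrite ger0_norm// invf_lt1// ltr1n.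
- by near=> k; rewrite /= -lee_fin fineK.
Unshelve. all: by end_near. Qed.

(** The affine change of variables sends t to 1 / 2 and [-L, L] into
    [1 / 4, 3 / 4], whatever t is. *)
Definition ray_poly L t n : {poly R} :=
  (1 - ((2^-1 - t / (4 * (L + `|t|)))%:P + (4 * (L + `|t|))^-1 *: 'X) ^+ n) ^+ (n * 2 ^ n).

Lemma horner_ray_poly L t n x :
  (ray_poly L t n).[x] = step_poly n (2^-1 + (x - t) / (4 * (L + `|t|))).
Proof.
rewrite /ray_poly /step_poly !hornerE; congr ((1 - _ ^+ _) ^+ _).
by rewrite mulrBl addrA addrAC [x * _]mulrC.
Qed.

Lemma cvg_ray_poly L t mu : 0 < L -> integrable_moments mu ->
  mu (~` `[- L, L]) = 0%E ->
  (\int[mu]_x ((ray_poly L t n).[x])%:E @[n --> \oo] --> mu `]-oo, t[%classic)%E.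
Proof.
move=> L0 im; set D := [set` _] => mL; have mD : measurable D by exact: measurable_itv.
pose M := 4 * (L + `|t|); have M0 : 0 < M by rewrite mulr_gt0// ltr_pwDl.
have y01 x : D x -> 0 <= 2^-1 + (x - t) / M <= 1.
  rewrite /D /= in_itv/= => /andP[x1 x2].
  have := ler_norm t; have := ler_norm (- t); rewrite normrN => t1 t2.
  have : - (4^-1) <= (x - t) / M <= 4^-1.
    by rewrite ler_pdivlMr// ler_pdivrMr// /M; apply/andP; split; lra.
  lra.
have restr n : (\int[mu]_x ((ray_poly L t n).[x])%:E =
    \int[mu]_(x in D) ((ray_poly L t n).[x])%:E)%E.
  rewrite (@negligible_integral _ _ _ mu setT (~` D))//.
  - by rewrite setTD setCK.
  - exact: measurableC.
  - exact: integrable_horner.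
under eq_fun do rewrite restr.
have mt : measurable [set` `]-oo, t[] by exact: measurable_itv.
have -> : (mu `]-oo, t[%classic = \int[mu]_(x in D) (\1_`]-oo, t[ x : R)%:E)%E.
  have z : mu ([set` `]-oo, t[] `\` D) = 0%E.
    by apply: (subset_measure0 _ _ _ mL) ; [exact: measurableD|exact: measurableC|move=> x []].
  rewrite integral_indic// [LHS](measureDI mu mt mD) -[RHS]add0e; congr (_ + _)%E; exact: z.
have m1 n : measurable_fun D (fun x : T => ((ray_poly L t n).[x])%:E).
  by apply/measurable_EFinP; exact: measurable_poly.
have m2 : measurable_fun D (fun x : T => (\1_`]-oo, t[ x : R)%:E).
  by apply/measurable_EFinP; exact: measurable_indic.
have h : {ae mu, forall x, D x ->
    ((ray_poly L t n).[x])%:E @[n --> \oo] --> (\1_`]-oo, t[ x : R)%:E}.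
  apply: aeW => x Dx; apply: cvg_EFin; first by near=> n.
  have := cvg_step_poly (y01 x Dx).
  have -> : (2^-1 + (x - t) / M < 2^-1) = (x < t).
    by rewrite gtrDl pmulr_llt0 ?invr_gt0// subr_lt0.
  have -> : \1_`]-oo, t[ x = (if x < t then 1 else 0) :> R.
    by rewrite indicE mem_setE in_itv/=; case: ifP.
  by under eq_fun do rewrite -horner_ray_poly.
have ic : mu.-integrable D (cst 1%E) by exact: finite_measure_integrable_cst.
have b1 : {ae mu, forall x n, D x -> (`|((ray_poly L t n).[x])%:E| <= cst 1 x)%E}.
  apply: aeW => x n Dx; rewrite lee_fin horner_ray_poly.
  by have /andP[h0 h1] := step_poly_itv n (y01 x Dx); rewrite ger0_norm.
have [_ _ H] := @dominated_convergence _ T R mu D mD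
  (fun n x => ((ray_poly L t n).[x])%:E) (fun x => (\1_`]-oo, t[ x : R)%:E)
  (cst 1%E) m1 m2 h ic b1.
exact: H.
Unshelve. all: by end_near. Qed.

(** Both measures are concentrated on [-2 L, 2 L], and they give the same integral
    to every polynomial. By dominated convergence they agree on all open
    half-lines, which generate the Borel sets and are stable under
    intersection. *)
Lemma moments_determine mu nu L : 0 < L -> mu (~` `[- L, L]) = 0%E ->
  integrable_moments mu -> integrable_moments nu ->
  (forall n, \int[mu]_x (x ^+ n)%:E = \int[nu]_x (x ^+ n)%:E)%E ->
  forall A : set T, measurable A -> mu A = nu A.
Proof.
move=> L0 mL imu inu e.
have L20 : 0 < L *+ 2 by rewrite pmulrn_lgt0.
have nL : nu (~` `[- (L *+ 2), L *+ 2]) = 0%E.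
  by apply: tail_of_moments => // k; rewrite -e; apply: even_moment_le => //; exact: ltW.
have {}mL : mu (~` `[- (L *+ 2), L *+ 2]) = 0%E.
  by apply: tail_of_moments => // k; apply: even_moment_le => //; exact: ltW.
have ray t : mu `]-oo, t[%classic = nu `]-oo, t[%classic.
  have E : (fun n => \int[mu]_x ((ray_poly (L *+ 2) t n).[x])%:E)%E =
           (fun n => \int[nu]_x ((ray_poly (L *+ 2) t n).[x])%:E)%E.
    by apply/funext => n; exact: integral_horner_eq.
  have := cvg_ray_poly (t := t) L20 imu mL; rewrite E => H.
  exact: (cvg_unique _ H (cvg_ray_poly (t := t) L20 inu nL)).
pose G : set (set T) := [set A | exists x, A = `]-oo, x[%classic].
pose g k : set T := `]-oo, k%:R[%classic.
move=> A mA; apply: (@measure_unique _ R T G g _ _ _ _ mu nu) => //.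
- exact: RGenInftyO.measurableE.
- move=> _ _ [x ->] [y ->]; exists (Num.min x y).
  apply/seteqP; split => z /=; rewrite !in_itv/= lt_min.
    by move=> [-> ->].
  by move=> /andP.
- by move=> i; exists i%:R.
- rewrite -subTset => x _; exists (Num.bound `|x : R|) => //=; rewrite /g /= in_itv/=.
  by apply: le_lt_trans (ler_norm (x : R)) _; apply: archi_boundP.
- by move=> _ [x ->]; exact: ray.
- move=> k; apply: (@le_lt_trans _ _ 1%E); last exact: ltry.
  by apply: probability_le1; exact: measurable_itv.
Qed.
End MomentDeterminacy.

(** * Integration against the Kesten measure *)

Section DensityMeasure.
Context d (T : measurableType d) (R : realType).
Variables (mu : {measure set T -> \bar R}) (f : T -> R).
Hypotheses (mf : measurable_fun setT f) (f0 : forall x, 0 <= f x).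
Local Open Scope ereal_scope.

Let dens (A : set T) : \bar R := \int[mu]_(x in A) (f x)%:E.

Let dens0 : dens set0 = 0. Proof. exact: integral_set0. Qed.

Let dens_ge0 A : 0 <= dens A.
Proof. by apply: integral_ge0 => x _; rewrite lee_fin. Qed.

Let dens_sigma_additive : semi_sigma_additive dens.
Proof.
apply: semi_sigma_additive_nng_induced; first exact/measurable_EFinP.
by move=> x; rewrite lee_fin.
Qed.

HB.instance Definition _ := isMeasure.Build _ _ _ dens dens0 dens_ge0 dens_sigma_additive.

Lemma exists_density_measure : exists nu : {measure set T -> \bar R},
  forall A, nu A = \int[mu]_(x in A) (f x)%:E.
Proof. by exists (dens : {measure set T -> \bar R}). Qed.

Import HBNNSimple.

(** The identity holds for indicators by hypothesis, for simple functions by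
    linearity, and passes to increasing limits. *)
Lemma ge0_integral_density (nu : {measure set T -> \bar R}) (g : T -> \bar R) :
  (forall A, measurable A -> nu A = \int[mu]_(x in A) (f x)%:E) ->
  measurable_fun setT g -> (forall x, 0 <= g x) ->
  \int[nu]_x g x = \int[mu]_x (g x * (f x)%:E).
Proof.
move=> nuE mg g0; pose g_ := nnsfun_approx measurableT mg.
have mfE : measurable_fun setT (fun x => (f x)%:E) by exact/measurable_EFinP.
have step (h : {nnsfun T >-> R}) : \int[nu]_x (h x)%:E = \int[mu]_x ((h x)%:E * (f x)%:E).
  under [LHS]eq_integral do rewrite fimfunE -fsumEFin//.
  rewrite [LHS]ge0_integral_fsum//; last 2 first.
  - by move=> r; exact/measurable_EFinP/measurableT_comp.
  - by move=> n x _; rewrite EFinM nnfun_muleindic_ge0.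
  under [RHS]eq_integral.
    move=> x _; rewrite fimfunE -fsumEFin// muleC ge0_mule_fsumr; last first.
      by move=> r; rewrite EFinM nnfun_muleindic_ge0.
    over.
  rewrite [RHS]ge0_integral_fsum//; last 2 first.
  - move=> r; apply: emeasurable_funM => //.
    by apply/measurable_EFinP; do 2 apply/measurableT_comp => //.
  - move=> n x _; apply: mule_ge0; first by rewrite lee_fin.
    by rewrite EFinM nnfun_muleindic_ge0.
  apply: eq_fsbigr => r _.
  have mr : measurable (h @^-1` [set r]) by exact: measurable_funPTI.
  under [LHS]eq_integral do rewrite EFinM.
  rewrite integralZl_indic_nnsfun//= integral_indic// setIT nuE//.
  have [r0|r0] := ltP r 0%R.
    rewrite preimage_nnfun0// integral_set0 mule0 integral0_eq// => x _.
    by rewrite indic0 mulr0 mule0.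
  under [RHS]eq_integral do rewrite EFinM muleCA.
  rewrite [RHS]ge0_integralZl//; last 2 first.
  - by apply: emeasurable_funM => //; apply/measurable_EFinP; exact: measurable_indic.
  - by move=> x _; rewrite mule_ge0// lee_fin.
  congr (_ * _); rewrite integral_mkcond; apply: eq_integral => x _.
  by rewrite patchE indicE; case: ifP; rewrite ?mule1 ?mule0.
transitivity (limn (fun n => \int[nu]_x (g_ n x)%:E)).
  rewrite -monotone_convergence//=.
  - apply: eq_integral => ? /[!inE] xD; apply/esym/cvg_lim => //=.
    exact: cvg_nnsfun_approx.
  - by move=> n; exact/measurable_EFinP/measurable_funTS.
  - by move=> n ? _; rewrite lee_fin.
  - by move=> ? _ ? ? mn; rewrite lee_fin; exact/lefP/nd_nnsfun_approx.
transitivity (limn (fun n => \int[mu]_x ((g_ n x)%:E * (f x)%:E))).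
  by apply: congr_lim; apply/funext => n; exact: step.
rewrite -monotone_convergence//=.
- apply: eq_integral => x _; apply/cvg_lim => //.
  apply: cvgeZr => //; exact: cvg_nnsfun_approx.
- move=> n; apply: emeasurable_funM => //.
  exact/measurable_EFinP/measurable_funTS.
- by move=> n x _; rewrite mule_ge0// lee_fin.
- move=> x _ m n mn; apply: lee_wpmul2r; rewrite lee_fin//.
  exact/lefP/nd_nnsfun_approx.
Qed.
End DensityMeasure.

Section Reflection.
Variable R : realType.
Local Notation T := (measurableTypeR R).

(** The image of the Lebesgue measure under reflection gives the same length to
    the bounded intervals. *)
Lemma lebesgue_measureN (A : set T) : measurable A ->
  lebesgue_measure (-%R @^-1` A) = lebesgue_measure A.
Proof.
move=> mA; have mN : measurable_fun [set: T] (-%R : T -> T) by exact: oppr_measurable.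
pose HN := isMeasurableFun.Build _ _ _ _ _ mN.
pose N : {mfun T >-> T} := HB.pack (-%R : T -> T) HN.
apply/esym; apply: (@lebesgue_measure_unique R (pushforward lebesgue_measure N)) => //.
move=> _ [[a b] _ <-]; rewrite /pushforward /=.
transitivity (lebesgue_measure (`[- b, - a[%classic : set T)); last first.
  congr (lebesgue_measure _); apply/seteqP; split => x /=; rewrite !in_itv/= => /andP[] ? ?;
    by apply/andP; split; lra.
rewrite !lebesgue_measure_itv/= !lte_fin ltrN2.
by case: ifP => // _; rewrite -!EFinB opprK addrC.
Qed.
End Reflection.

Section KestenIntegral.
Variables (R : realType) (p q : R).
Hypotheses (hp : 0 <= p) (hq : 0 <= q).
Local Notation T := (measurableTypeR R).
Local Notation f := (kesten_density p q).
Local Notation alpha := (kesten_atom p q).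

(** With y = x ^ 2 between 0 and 2 s, the denominator is at least
    2 (1 - s) ^ 2 when s <= 2, and at least 2 otherwise. It vanishes only at the
    end points, and only for s = 1. *)
Lemma kesten_denom_ge0 x :
  - Num.sqrt (2 * (p + q)) <= x <= Num.sqrt (2 * (p + q)) ->
  0 <= 2 - (2 - p - q) * x ^+ 2.
Proof.
move=> /andP[x1 x2]; have s0 : 0 <= p + q by rewrite addr_ge0.
have x2s : x ^+ 2 <= 2 * (p + q).
  rewrite -(sqr_sqrtr (_ : 0 <= 2 * (p + q))); last by rewrite mulr_ge0.
  by rewrite -(real_normK (num_real x)) lerXn2r ?nnegrE ?sqrtr_ge0// ler_norml x1.
have := sqr_ge0 x; have -> : 2 - p - q = 2 - (p + q) by ring.
move: (p + q) s0 (x ^+ 2) x2s => s s0 y ys y0.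
have [s2|s2] := leP s 2; last nra.
have : (2 - s) * y <= (2 - s) * (2 * s) by rewrite ler_wpM2l// subr_ge0.
have := sqr_ge0 (1 - s); nra.
Qed.

Lemma kesten_density_ge0 x : 0 <= f x.
Proof.
rewrite /kesten_density; case: ifP => // xs.
by rewrite mulr_ge0 ?invr_ge0 ?pi_ge0// divr_ge0 ?sqrtr_ge0// kesten_denom_ge0.
Qed.

Lemma kesten_densityN x : f (- x) = f x.
Proof. by rewrite /kesten_density sqrrN lerN2 lerNl andbC. Qed.

(** Where the denominator matters it is nonnegative, and there its inverse is a
    real power, a measurable function on the whole line. *)
Lemma measurable_kesten_density : measurable_fun [set: T] (f : T -> R).
Proof.
have -> : f = (fun x => if - Num.sqrt (2 * (p + q)) <= x <= Num.sqrt (2 * (p + q)) then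
    pi^-1 * (Num.sqrt (2 * (p + q) - x ^+ 2) * (2 - (2 - p - q) * x ^+ 2) `^ (-1)) else 0).
  apply/funext => x; rewrite /kesten_density; case: ifP => // xs.
  by rewrite powR_inv1// kesten_denom_ge0.
apply: measurable_fun_ifT => //=.
- by apply: measurable_and; apply: measurable_fun_ler.
- apply: measurable_funM => //; apply: measurable_funM => //.
    apply: (measurableT_comp (f := @Num.sqrt R)).
      by apply: continuous_measurable_fun; exact: sqrt_continuous.
    by apply: measurable_funB => //; exact: measurable_funX.
  apply: (measurableT_comp (f := @powR R ^~ (-1))); first exact: measurable_powR.
  by apply: measurable_funB => //; apply: measurable_funM => //; exact: measurable_funX.
Qed.
Local Open Scope ereal_scope.

Section KestenMeasure.
Variables (mu : probability T R) (c : R).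
Hypotheses (c0 : (0 <= c)%R)
  (muE : forall A : set T, measurable A ->
    mu A = \int[@lebesgue_measure R]_(x in A) (f x)%:E
         + c%:E * (\d_alpha A + \d_(- alpha)%R A)).

(** The measure is the sum of a measure with density and of two weighted Dirac
    masses, since it agrees with this sum on measurable sets. *)
Lemma ge0_integral_kesten (g : T -> \bar R) : measurable_fun setT g -> (forall x, 0 <= g x) ->
  \int[mu]_x g x = \int[@lebesgue_measure R]_x (g x * (f x)%:E) +
    c%:E * (g alpha + g (- alpha)%R).
Proof.
move=> mg g0.
have [nu nuE] := exists_density_measure (@lebesgue_measure R)
  measurable_kesten_density kesten_density_ge0.
pose atoms : {measure set T -> \bar R} :=
  mscale (NngNum c0) (measure_add (\d_(alpha : T)) (\d_((- alpha)%R : T))).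
rewrite (@eq_measure_integral _ T R setT (measure_add nu atoms)); last first.
  move=> A mA _; apply: etrans (esym (measure_addE nu atoms A)).
  apply: etrans (muE mA) _; rewrite nuE; congr (_ + _ * _).
  exact: (esym (measure_addE (\d_(alpha : T)) (\d_((- alpha)%R : T)) A)).
rewrite ge0_integral_measure_add//; congr (_ + _).
  by apply: (ge0_integral_density measurable_kesten_density kesten_density_ge0) => //.
rewrite ge0_integral_mscale//= ge0_integral_measure_add// !integral_dirac//.
by rewrite !diracT !mul1e.
Qed.

(** The density is even and the two atoms are exchanged by reflection. *)
Lemma kesten_measureN (A : set T) : measurable A -> mu (-%R @^-1` A) = mu A.
Proof.
move=> mA.
have mN : measurable_fun [set: T] (-%R : T -> T) by exact: oppr_measurable.
have mNA : measurable (-%R @^-1` A : set T).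
  by rewrite -[X in measurable X]setTI; exact: mN.
rewrite !muE//; congr (_ + _ * _).
  have mfE : measurable_fun [set: T] (fun x : T => (f x)%:E).
    by apply/measurable_EFinP; exact: measurable_kesten_density.
  under eq_integral do rewrite -kesten_densityN.
  rewrite -(@ge0_integral_pushforward _ _ T T R -%R mN (@lebesgue_measure R) A
    (fun x => (f x)%:E))//.
  - by apply: eq_measure_integral => B mB _; exact: lebesgue_measureN.
  - exact: measurable_funTS.
  - by move=> x _; rewrite lee_fin kesten_density_ge0.
have mE (x : T) : (x \in (-%R @^-1` A : set T)) = ((- x)%R \in A).
  by apply/idP/idP; rewrite !inE.
by rewrite addeC !diracE !mE opprK.
Qed.

End KestenMeasure.
End KestenIntegral.

(** * Improper integrals over a symmetric interval *)

Section SymmetricInterval.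
Variable R : realType.
Implicit Types (f g h H : R -> R) (a b k l x : R).
Local Notation lebesgue := (@lebesgue_measure R).

Lemma is_derive1_mul f g x df dg d : is_derive x 1 f df -> is_derive x 1 g dg ->
  d = f x * dg + df * g x -> is_derive x 1 (fun y => f y * g y) d.
Proof.
move=> hf hg ->; have H := is_deriveM hf hg.
suff e : f x *: dg + g x *: df = f x * dg + df * g x by rewrite -e; exact: H.
by rewrite /GRing.scale/= [g x * _]mulrC.
Qed.

Lemma is_derive1_add f g x df dg : is_derive x 1 f df -> is_derive x 1 g dg ->
  is_derive x 1 (fun y => f y + g y) (df + dg).
Proof. by move=> hf hg; exact: (is_deriveD hf hg). Qed.

Lemma is_derive1_scale k f x df : is_derive x 1 f df ->
  is_derive x 1 (fun y => k * f y) (k * df).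
Proof.
by move=> hf; apply: (is_derive1_mul (is_derive_cst k x 1) hf); rewrite mul0r addr0.
Qed.

Lemma is_derive1_sqrt_comp f x df : 0 < f x -> is_derive x 1 f df ->
  is_derive x 1 (fun y => Num.sqrt (f y)) (df / (2 * Num.sqrt (f x))).
Proof.
move=> f0 hf; have H := is_derive1_comp (is_derive1_sqrt f0) hf.
by rewrite mulrC; exact: H.
Qed.

(** The intervals [- half_width a n, half_width a n] increase to ]-a, a[. They
    are the sets where |x / sqrt (a ^ 2 - x ^ 2)| <= n; the primitives used
    below are functions of this slope, which takes the value n at the right end
    point. *)
Definition half_width a (n : nat) : R := a * n%:R / Num.sqrt (1 + n%:R ^+ 2).

Lemma half_width_itv a n : 0 < a -> 0 <= half_width a n < a.
Proof.
move=> a0; have n1 : 0 < 1 + n%:R ^+ 2 :> R by rewrite ltr_pwDl// sqr_ge0.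
apply/andP; split; first by rewrite divr_ge0 ?sqrtr_ge0// mulr_ge0// ltW.
rewrite /half_width ltr_pdivrMr ?sqrtr_gt0// ltr_pM2l//.
have e : Num.sqrt (n%:R ^+ 2) = n%:R :> R by rewrite sqrtr_sqr ger0_norm.
by rewrite -{1}e ltr_sqrt// ltrDr.
Qed.

Lemma le_half_width a x n : 0 < a -> 0 <= x ->
  (x <= half_width a n) = (x ^+ 2 * (1 + n%:R ^+ 2) <= a ^+ 2 * n%:R ^+ 2).
Proof.
move=> a0 x0; have n1 : 0 < 1 + n%:R ^+ 2 :> R by rewrite ltr_pwDl// sqr_ge0.
rewrite /half_width ler_pdivlMr ?sqrtr_gt0//.
rewrite -[LHS]ler_sqr ?nnegrE; first by rewrite !exprMn sqr_sqrtr// ltW.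
  by rewrite mulr_ge0// sqrtr_ge0.
by rewrite mulr_ge0// ltW.
Qed.

Lemma sqrt_half_width a n : 0 < a ->
  Num.sqrt (a ^+ 2 - half_width a n ^+ 2) = a / Num.sqrt (1 + n%:R ^+ 2).
Proof.
move=> a0; have n1 : 0 < 1 + n%:R ^+ 2 :> R by rewrite ltr_pwDl// sqr_ge0.
have -> : a ^+ 2 - half_width a n ^+ 2 = (a / Num.sqrt (1 + n%:R ^+ 2)) ^+ 2.
  rewrite /half_width !exprMn !exprVn sqr_sqrtr 1?ltW//.
  by field; rewrite gt_eqF.
by rewrite sqrtr_sqr ger0_norm// divr_ge0 ?sqrtr_ge0// ltW.
Qed.

Lemma slope_half_width a n : 0 < a ->
  half_width a n / Num.sqrt (a ^+ 2 - half_width a n ^+ 2) = n%:R.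
Proof.
move=> a0; rewrite sqrt_half_width// /half_width.
have n1 : 0 < 1 + n%:R ^+ 2 :> R by rewrite ltr_pwDl// sqr_ge0.
by field; rewrite !gt_eqF ?sqrtr_gt0.
Qed.

Lemma bigcup_half_width a : 0 < a ->
  \bigcup_n `[- half_width a n, half_width a n]%classic = `]- a, a[%classic.
Proof.
move=> a0; apply/seteqP; split => x /=.
  move=> [n _ /=]; rewrite !in_itv/= => /andP[x1 x2].
  by have /andP[_ ?] := half_width_itv n a0; apply/andP; split; lra.
rewrite in_itv/= => /andP[x1 x2].
have xa : 0 < a ^+ 2 - x ^+ 2 by rewrite subr_sqr mulr_gt0//; lra.
pose n := Num.bound (x ^+ 2 / (a ^+ 2 - x ^+ 2)).
exists n => //=; rewrite in_itv/= -ler_norml le_half_width//.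
rewrite real_normK ?num_real// -subr_ge0.
have : x ^+ 2 / (a ^+ 2 - x ^+ 2) < n%:R.
  by apply: archi_boundP; rewrite divr_ge0 ?sqr_ge0// ltW.
rewrite ltr_pdivrMr// => H.
have nn : n%:R <= n%:R ^+ 2 :> R.
  by rewrite -natrX ler_nat; case: (n) => // m; rewrite leq_pmulr.
have : n%:R * (a ^+ 2 - x ^+ 2) <= n%:R ^+ 2 * (a ^+ 2 - x ^+ 2) by rewrite ler_wpM2r// ltW.
lra.
Qed.

Lemma half_width_nondecreasing a : 0 < a -> nondecreasing_seq (half_width a).
Proof.
move=> a0 m n mn; have /andP[m0 _] := half_width_itv m a0.
rewrite le_half_width// /half_width !exprMn exprVn.
have n1 : 0 < 1 + m%:R ^+ 2 :> R by rewrite ltr_pwDl// sqr_ge0.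
rewrite (sqr_sqrtr (ltW n1)) [leLHS]mulrAC ler_pdivrMr// -subr_ge0.
rewrite (_ : _ - _ = a ^+ 2 * (n%:R ^+ 2 - m%:R ^+ 2)); last by ring.
by rewrite mulr_ge0 ?sqr_ge0// subr_ge0 -!natrX ler_nat leq_exp2r.
Qed.

(** The integrand may be unbounded at the end points (it is for the Kesten density
    with s = 1). The fundamental theorem of calculus is applied on the
    intervals [- half_width a n, half_width a n], and monotone convergence does
    the rest. *)
Lemma integral_symmetric_FTC h H a l : 0 < a ->
  (forall x, - a < x < a -> 0 <= h x) ->
  (forall x, - a < x < a -> {for x, continuous h}) ->
  (forall x, - a < x < a -> is_derive x 1 H (h x)) ->
  (H (half_width a n) - H (- half_width a n)) @[n --> \oo] --> l ->
  (\int[lebesgue]_(x in `](- a)%R, a[) (h x)%:E = l%:E)%E.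
Proof.
move=> a0 h0 ch dH cl.
have sub n x : - half_width a n <= x <= half_width a n -> - a < x < a.
  by have /andP[_ ?] := half_width_itv n a0 => /andP[? ?]; apply/andP; split; lra.
have cw n : {within `[- half_width a n, half_width a n], continuous h}.
  apply: continuous_in_subspaceT => x; rewrite inE/= in_itv/= => /sub; exact: ch.
rewrite -bigcup_half_width//.
have E n : (0 < n)%N ->
  (\int[lebesgue]_(x in `[(- half_width a n)%R, half_width a n]) (h x)%:E =
   (H (half_width a n) - H (- half_width a n))%:E)%E.
  move=> n0; have b0 : 0 < half_width a n.
    by rewrite divr_gt0 ?mulr_gt0 ?ltr0n// sqrtr_gt0 ltr_pwDl// sqr_ge0.
  have dHH x : - half_width a n <= x <= half_width a n -> derivable H x 1.
    by move=> /sub/dH hx; apply: ex_derive.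
  have cH x : - half_width a n <= x <= half_width a n -> {for x, continuous H}.
    by move=> /dHH/derivable1_diffP/differentiable_continuous.
  rewrite (@continuous_FTC2 R h H)//; first lra.
  - split.
    + by move=> x; rewrite in_itv/= => /andP[x1 x2]; apply: dHH; rewrite !ltW.
    + by apply: cvg_at_right_filter; apply: cH; lra.
    + by apply: cvg_at_left_filter; apply: cH; lra.
  - move=> x; rewrite in_itv/= => /andP[x1 x2].
    by rewrite derive1E; apply: derive_val; apply: dH; apply: (sub n); rewrite !ltW.
pose F n : set (measurableTypeR R) := `[- half_width a n, half_width a n]%classic.
have ndF : {homo F : n m / (n <= m)%N >-> (n <= m)%O}.
  move=> n m nm; apply/subsetPset => x; rewrite /F /= !in_itv/= => /andP[x1 x2].
  by have := half_width_nondecreasing a0 nm; move=> ?; apply/andP; split; lra.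
have mF n : measurable (F n) by exact: measurable_itv.
have mfF n : measurable_fun (F n) (fun x : measurableTypeR R => (h x)%:E).
  by apply/measurable_EFinP; apply: subspace_continuous_measurable_fun (cw n).
have f0F n (x : measurableTypeR R) : F n x -> (0 <= (h x)%:E)%E.
  by rewrite /F /= in_itv/= lee_fin => /sub/h0.
have cvg1 := @ge0_nondecreasing_set_cvg_integral _ _ R F (fun x => (h x)%:E)
  lebesgue_measure ndF mF mfF f0F.
apply: (cvg_unique _ cvg1) => //.
apply: (@cvg_trans _ ((H (half_width a n) - H (- half_width a n))%:E @[n --> \oo])); last first.
  by apply: cvg_EFin; [near=> n|exact: cl].
apply: near_eq_cvg; near=> n; apply/esym/E; near: n; exact: nbhs_infty_gt.
Unshelve. all: by end_near. Qed.
End SymmetricInterval.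

(** * Integrals of the semicircle *)

Section Semicircle.
Variables (R : realType) (a : R).
Hypothesis a0 : 0 < a.
Implicit Types (k x : R).
Local Notation lebesgue := (@lebesgue_measure R).

Definition semicircle x : R := Num.sqrt (a ^+ 2 - x ^+ 2).
Local Notation w := semicircle.

Lemma semicircle_gt0 x : - a < x < a -> 0 < w x.
Proof.
by move=> /andP[x1 x2]; rewrite sqrtr_gt0 subr_sqr mulr_gt0//; lra.
Qed.

Lemma sqr_semicircle x : - a <= x <= a -> w x ^+ 2 = a ^+ 2 - x ^+ 2.
Proof.
by move=> /andP[x1 x2]; rewrite sqr_sqrtr// subr_sqr mulr_ge0//; lra.
Qed.

Lemma is_derive_semicircle x : - a < x < a -> is_derive x 1 w (- x / w x).
Proof.
move=> xa; have w0 := semicircle_gt0 xa.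
have dq : is_derive x 1 (fun y => a ^+ 2 - y ^+ 2) (- (2 * x)).
  have H : is_derive x 1 (cst (a ^+ 2) - (id : R -> R) ^+ 2) (0 - 2%:R * x ^+ 1 *: 1).
    exact: is_deriveB.
  by suff <- : 0 - 2%:R * x ^+ 1 *: 1 = - (2 * x) by []; rewrite expr1 /GRing.scale/=; ring.
have q0 : 0 < a ^+ 2 - x ^+ 2 by rewrite -sqrtr_gt0.
have := @is_derive1_sqrt_comp R (fun y => a ^+ 2 - y ^+ 2) x _ q0 dq; rewrite -/(w x).
suff -> : - (2 * x) / (2 * w x) = - x / w x by [].
by field; rewrite gt_eqF.
Qed.

Lemma continuous_semicircle : continuous w.
Proof.
move=> x; apply: (@continuous_comp _ _ _ (fun y : R => a ^+ 2 - y ^+ 2) (@Num.sqrt R));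
  last exact: sqrt_continuous.
by apply: cvgB; [exact: cvg_cst|exact: exprn_continuous].
Qed.

Lemma semicircleN x : w (- x) = w x.
Proof. by rewrite /semicircle sqrrN. Qed.

(** With u = x / w x one has u' = a ^ 2 / w ^ 3, because w ^ 2 + x ^ 2 = a ^ 2. *)
Lemma is_derive_atan_slope k x : - a < x < a ->
  is_derive x 1 (fun y => atan (k * (y / w y)))
    (k * a ^+ 2 / (w x * (w x ^+ 2 + k ^+ 2 * x ^+ 2))).
Proof.
move=> xa; have w0 := semicircle_gt0 xa; have wn : w x != 0 by rewrite gt_eqF.
have xa' : - a <= x <= a by case/andP: xa => ? ?; rewrite !ltW.
have w2 := sqr_semicircle xa'.
have dV : is_derive x 1 (fun y => (w y)^-1) (x / w x ^+ 3).
  have H := is_deriveV wn (is_derive_semicircle xa).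
  suff <- : - w x ^- 2 *: (- x / w x) = x / w x ^+ 3 by exact: H.
  by rewrite /GRing.scale/=; field.
have did : is_derive x 1 (fun y : R => y) 1 by exact: is_derive_id.
have du : is_derive x 1 (fun y => y / w y) (a ^+ 2 / w x ^+ 3).
  apply: (is_derive1_mul did dV).
  have -> : a ^+ 2 = w x ^+ 2 + x ^+ 2 by rewrite w2; ring.
  by field.
have dk : is_derive x 1 (fun y => k * (y / w y)) (k * (a ^+ 2 / w x ^+ 3)).
  exact: is_derive1_scale.
have H := @is_derive1_comp R (@atan R) (fun y => k * (y / w y)) x _ _
  (is_derive1_atan (k * (x / w x))) dk.
suff <- : (1 + (k * (x / w x)) ^+ 2)^-1 * (k * (a ^+ 2 / w x ^+ 3)) =
  k * a ^+ 2 / (w x * (w x ^+ 2 + k ^+ 2 * x ^+ 2)) by exact: H.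
have d0 : 0 < w x ^+ 2 + k ^+ 2 * x ^+ 2.
  by rewrite ltr_pwDl ?exprn_gt0// mulr_ge0// sqr_ge0.
have -> : 1 + (k * (x / w x)) ^+ 2 = (w x ^+ 2 + k ^+ 2 * x ^+ 2) / w x ^+ 2 by field.
by field; rewrite exprMn wn gt_eqF.
Qed.

Lemma atan_half_width k n :
  atan (k * (half_width a n / w (half_width a n))) -
  atan (k * (- half_width a n / w (- half_width a n))) = 2 * atan (k * n%:R).
Proof.
rewrite semicircleN mulNr mulrN atanN opprK.
by rewrite /semicircle slope_half_width//; ring.
Qed.

Lemma cvg_mul_atan k : 0 <= k -> k * atan (k * n%:R) @[n --> \oo] --> k * (pi / 2).
Proof.
rewrite le_eqVlt => /predU1P[<-|k0].
  by under eq_fun do rewrite mul0r; rewrite mul0r; exact: cvg_cst.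
apply: cvgMl_tmp; apply: (cvg_comp (fun n => k * n%:R) (@atan R)); last exact: cvgy_atan.
exact: (cvg_comp (fun n => n%:R) ( *%R k) cvgr_idn (gt0_cvgMry k0 cvg_id)).
Qed.

Lemma integral_itvoo_itvcc (g : R -> R) :
  measurable_fun [set: measurableTypeR R] (g : measurableTypeR R -> R) ->
  (\int[lebesgue]_(x in `](- a)%R, a[) (g x)%:E =
   \int[lebesgue]_(x in `[(- a)%R, a]) (g x)%:E)%E.
Proof.
move=> mg; rewrite integral_itv_bndo_bndc; last first.
  by apply/measurable_EFinP; exact: measurable_funTS.
by rewrite integral_itv_obnd_cbnd//; apply/measurable_EFinP; exact: measurable_funTS.
Qed.

Lemma measurable_semicircle : measurable_fun [set: measurableTypeR R] (w : measurableTypeR R -> R).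
Proof. by apply: continuous_measurable_fun; exact: continuous_semicircle. Qed.

(** Primitive: (x w + a ^ 2 atan (x / w)) / 2. *)
Lemma integral_semicircle :
  (\int[lebesgue]_(x in `[(- a)%R, a]) (w x)%:E = (pi * a ^+ 2 / 2)%:E)%E.
Proof.
rewrite -integral_itvoo_itvcc; last exact: measurable_semicircle.
pose H x := 2^-1 * (x * w x + a ^+ 2 * atan (1 * (x / w x))).
apply: (@integral_symmetric_FTC R w H a _ a0).
- by move=> x _; rewrite sqrtr_ge0.
- by move=> x _; exact: continuous_semicircle.
- move=> x xa; have w0 := semicircle_gt0 xa; have wn : w x != 0 by rewrite gt_eqF.
  have xa' : - a <= x <= a by case/andP: xa => ? ?; rewrite !ltW.
  have w2 := sqr_semicircle xa'.
  have did : is_derive x 1 (fun y : R => y) 1 by exact: is_derive_id.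
  have d1 : is_derive x 1 (fun y => y * w y) (w x - x ^+ 2 / w x).
    by apply: (is_derive1_mul did (is_derive_semicircle xa)); field.
  have d2 : is_derive x 1 (fun y => a ^+ 2 * atan (1 * (y / w y))) (a ^+ 2 / w x).
    have := is_derive1_scale (a ^+ 2) (is_derive_atan_slope 1 xa).
    have -> : w x ^+ 2 + 1 ^+ 2 * x ^+ 2 = a ^+ 2 by rewrite w2; ring.
    suff -> : a ^+ 2 * (1 * a ^+ 2 / (w x * a ^+ 2)) = a ^+ 2 / w x by [].
    by field; rewrite wn gt_eqF.
  have := is_derive1_scale 2^-1 (is_derive1_add d1 d2); rewrite -/(H).
  suff -> : 2^-1 * (w x - x ^+ 2 / w x + a ^+ 2 / w x) = w x by [].
  have -> : a ^+ 2 = w x ^+ 2 + x ^+ 2 by rewrite w2; ring.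
  by field.
have -> : (fun n => H (half_width a n) - H (- half_width a n)) =
   (fun n => half_width a n * w (half_width a n) + a ^+ 2 * (1 * atan (1 * n%:R))).
  apply/funext => n; rewrite /H.
  transitivity (half_width a n * w (half_width a n) + a ^+ 2 / 2 *
    (atan (1 * (half_width a n / w (half_width a n))) -
     atan (1 * (- half_width a n / w (- half_width a n))))).
    by rewrite !semicircleN; field.
  by rewrite atan_half_width; field.
rewrite (_ : pi * a ^+ 2 / 2 = 0 + a ^+ 2 * (1 * (pi / 2))); last by field.
apply: cvgD; last by apply: cvgMl_tmp; exact: cvg_mul_atan.
apply: (@squeeze_cvgr _ _ _ _ (cst 0) (fun n => (2 * a ^+ 2) * n.+1%:R^-1)).
- near=> n; rewrite /semicircle sqrt_half_width// /half_width.
  have n1 : 0 < 1 + n%:R ^+ 2 :> R by rewrite ltr_pwDl// sqr_ge0.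
  have -> : a * n%:R / Num.sqrt (1 + n%:R ^+ 2) * (a / Num.sqrt (1 + n%:R ^+ 2)) =
      a ^+ 2 * n%:R / (1 + n%:R ^+ 2).
    by rewrite mulf_div -[X in _ / X]expr2 (sqr_sqrtr (ltW n1)); congr (_ / _); ring.
  apply/andP; split; first by apply: divr_ge0; [rewrite mulr_ge0 // sqr_ge0|exact: ltW].
  rewrite ler_pdivrMr// [leRHS]mulrAC ler_pdivlMr// -[n.+1]addn1 natrD -subr_ge0.
  rewrite (_ : _ - _ = a ^+ 2 * ((n%:R - 1) ^+ 2 + 1 + n%:R)); last by ring.
  by rewrite mulr_ge0 ?sqr_ge0// addr_ge0// addr_ge0// sqr_ge0.
- exact: cvg_cst.
- by rewrite -(mulr0 (2 * a ^+ 2)); apply: cvgMl_tmp; exact: cvg_harmonic.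
Unshelve. all: by end_near. Qed.

(** For k distinct from 1 a primitive of w / D is
    a ^ 2 (atan u - k atan (k u)) / (1 - k ^ 2), where u = x / w, by partial
    fractions in u ^ 2. For k = 1 the denominator D is 1 on the interval. *)
Lemma integral_semicircle_ratio k (D : R -> R) : 0 <= k ->
  (forall x, D x = (w x ^+ 2 + k ^+ 2 * x ^+ 2) / a ^+ 2) ->
  (\int[lebesgue]_(x in `](- a)%R, a[) (w x / D x)%:E =
   (pi * a ^+ 2 / (1 + k))%:E)%E.
Proof.
move=> k0 DE; have [k1|k1] := eqVneq k 1.
  rewrite (_ : 1 + k = 2) -?integral_semicircle; last by rewrite k1; ring.
  rewrite -integral_itvoo_itvcc; last exact: measurable_semicircle.
  apply: eq_integral => x; rewrite inE/= in_itv/= => /andP[x1 x2]; congr EFin.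
  rewrite DE k1 expr1n mul1r sqr_semicircle ?(ltW x1) ?(ltW x2)//.
  by rewrite subrK divff ?divr1// expf_neq0// gt_eqF.
have D0 x : - a < x < a -> 0 < D x.
  move=> xa; rewrite DE divr_gt0 ?exprn_gt0// ltr_pwDl ?exprn_gt0 ?semicircle_gt0//.
  by rewrite mulr_ge0// sqr_ge0.
have k2 : 1 - k ^+ 2 != 0.
  rewrite (_ : 1 - k ^+ 2 = (1 - k) * (1 + k)); last by ring.
  by apply: mulf_neq0; [rewrite subr_eq0 eq_sym|rewrite gt_eqF // ltr_pwDl].
pose H x := a ^+ 2 / (1 - k ^+ 2) *
  (atan (1 * (x / w x)) + (- k) * atan (k * (x / w x))).
apply: (@integral_symmetric_FTC R (fun x => w x / D x) H a _ a0).
- by move=> x xa; rewrite divr_ge0 ?sqrtr_ge0// ltW// D0.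
- move=> x xa; apply: cvgM; first exact: continuous_semicircle.
  apply: cvgV; first by rewrite gt_eqF// D0.
  have -> : D = (fun x => (w x ^+ 2 + k ^+ 2 * x ^+ 2) / a ^+ 2) by apply/funext.
  apply: cvgMr_tmp; apply: cvgD; last by apply: cvgMl_tmp; exact: exprn_continuous.
  by rewrite expr2; under eq_fun do rewrite expr2; apply: cvgM; exact: continuous_semicircle.
- move=> x xa; have w0 := semicircle_gt0 xa; have wn : w x != 0 by rewrite gt_eqF.
  have xa' : - a <= x <= a by case/andP: xa => ? ?; rewrite !ltW.
  have w2 := sqr_semicircle xa'.
  have := is_derive1_scale (a ^+ 2 / (1 - k ^+ 2)) (is_derive1_add
    (is_derive_atan_slope 1 xa) (is_derive1_scale (- k) (is_derive_atan_slope k xa))).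
  rewrite -/(H); set d := (X in is_derive _ _ _ X); suff -> : d = w x / D x by [].
  rewrite {}/d.
  have e : w x ^+ 2 + 1 ^+ 2 * x ^+ 2 = a ^+ 2 by rewrite w2; ring.
  have Dn : w x ^+ 2 + k ^+ 2 * x ^+ 2 != 0.
    by have := D0 x xa; rewrite DE; apply: contraTneq => ->; rewrite mul0r ltxx.
  rewrite e DE; have an : a != 0 by rewrite gt_eqF.
  have e2 : a ^+ 2 = w x ^+ 2 + x ^+ 2 by rewrite w2; ring.
  transitivity (w x * a ^+ 2 / (w x ^+ 2 + k ^+ 2 * x ^+ 2)); last by field; rewrite ?exprMn Dn an.
  transitivity (a ^+ 2 * ((w x ^+ 2 + k ^+ 2 * x ^+ 2) - k ^+ 2 * (w x ^+ 2 + x ^+ 2)) /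
     ((1 - k ^+ 2) * w x * (w x ^+ 2 + k ^+ 2 * x ^+ 2))).
    by rewrite -e2; field; rewrite ?exprMn Dn an wn k2.
  by field; rewrite ?exprMn Dn wn k2.
have -> : (fun n => H (half_width a n) - H (- half_width a n)) =
   (fun n => 2 * a ^+ 2 / (1 - k ^+ 2) * (1 * atan (1 * n%:R) - k * atan (k * n%:R))).
  apply/funext => n; rewrite /H.
  transitivity (a ^+ 2 / (1 - k ^+ 2) *
    ((atan (1 * (half_width a n / w (half_width a n))) -
     atan (1 * (- half_width a n / w (- half_width a n)))) - k * 
     (atan (k * (half_width a n / w (half_width a n))) -
     atan (k * (- half_width a n / w (- half_width a n)))))).
    by ring.
  by rewrite !atan_half_width; field.
have kk : 1 + k != 0 by rewrite gt_eqF// ltr_pwDl.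
have -> : pi * a ^+ 2 / (1 + k) = 2 * a ^+ 2 / (1 - k ^+ 2) * (1 * (pi / 2) - k * (pi / 2)).
  by field; rewrite k2 kk.
by apply: cvgMl_tmp; apply: cvgB; exact: cvg_mul_atan.
Qed.

Lemma continuous_exp_semicircle n : continuous (fun x : R => x ^+ n * w x).
Proof. by move=> x; apply: cvgM; [exact: exprn_continuous|exact: continuous_semicircle]. Qed.

Lemma integrable_exp_semicircle n :
  lebesgue.-integrable `[- a, a] (fun x => (x ^+ n * w x)%:E).
Proof.
apply: continuous_compact_integrable; first exact: segment_compact.
by apply: continuous_subspaceT; exact: continuous_exp_semicircle.
Qed.

Lemma integral_exp_semicircle_fin_num n :
  (\int[lebesgue]_(x in `[(- a)%R, a]) (x ^+ n * w x)%:E)%E \is a fin_num.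
Proof.
have mI : measurable ([set` `[- a, a]] : set (measurableTypeR R)) by exact: measurable_itv.
exact: (integrable_fin_num mI (integrable_exp_semicircle n)).
Qed.

(** The function x ^ (n+1) (a ^ 2 - x ^ 2) w vanishes at both ends, hence its
    derivative ((n + 1) a ^ 2 x ^ n - (n + 4) x ^ (n+2)) w has integral
    zero. *)
Lemma integral_exp_semicircle_rec n :
  ((n%:R + 4)%:E * \int[lebesgue]_(x in `[(- a)%R, a]) (x ^+ n.+2 * w x)%:E =
   ((n%:R + 1) * a ^+ 2)%:E * \int[lebesgue]_(x in `[(- a)%R, a]) (x ^+ n * w x)%:E)%E.
Proof.
pose F x := x ^+ n.+1 * ((a ^+ 2 - x ^+ 2) * w x).
pose f x := (n%:R + 1) * a ^+ 2 * (x ^+ n * w x) - (n%:R + 4) * (x ^+ n.+2 * w x).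
have cf : continuous f.
  by move=> x; apply: cvgB; apply: cvgMl_tmp; exact: continuous_exp_semicircle.
have cF : continuous F.
  move=> x; apply: cvgM; first exact: exprn_continuous.
  apply: cvgM; last exact: continuous_semicircle.
  by apply: cvgB; [exact: cvg_cst|exact: exprn_continuous].
have dF x : - a < x < a -> is_derive x 1 F (f x).
  move=> xa; have w0 := semicircle_gt0 xa; have wn : w x != 0 by rewrite gt_eqF.
  have xa' : - a <= x <= a by case/andP: xa => ? ?; rewrite !ltW.
  have w2 := sqr_semicircle xa'.
  have dX m : is_derive x 1 (fun y : R => y ^+ m.+1) (m.+1%:R * x ^+ m).
    have H := is_deriveX m.+1 (is_derive_id x (1 : R)); rewrite exprfctE in H.
    suff <- : m.+1%:R * x ^+ m *: 1 = m.+1%:R * x ^+ m by exact: H.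
    by rewrite /GRing.scale/= mulr1.
  have dq : is_derive x 1 (fun y : R => a ^+ 2 - y ^+ 2) (- (2 * x)).
    have H := is_derive1_add (is_derive_cst (a ^+ 2) x 1) (is_derive1_scale (-1) (dX 1%N)).
    have e : (fun y => cst (a ^+ 2) y + -1 * y ^+ 2) = (fun y => a ^+ 2 - y ^+ 2).
      by apply/funext => y; rewrite mulN1r.
    rewrite -e; suff <- : 0 + -1 * (2 * x ^+ 1) = - (2 * x) by exact: H.
    by rewrite expr1; ring.
  have dG : is_derive x 1 (fun y => (a ^+ 2 - y ^+ 2) * w y) (- (3 * x * w x)).
    apply: (is_derive1_mul dq (is_derive_semicircle xa)); rewrite -w2; by field.
  apply: (is_derive1_mul (dX n) dG); rewrite /f -w2.
  have -> : a ^+ 2 = w x ^+ 2 + x ^+ 2 by rewrite w2; ring.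
  by rewrite -natr1 !exprS; ring.
have : (\int[lebesgue]_(x in `[(- a)%R, a]) (f x)%:E = (F a)%:E - (F (- a))%:E)%E.
  apply: (@continuous_FTC2 R f F); first by rewrite -subr_gt0 opprK addr_gt0.
  - exact: continuous_subspaceT.
  - split.
    + by move=> x; rewrite in_itv/= => /dF ?; apply: ex_derive.
    + by apply: cvg_at_right_filter; exact: cF.
    + by apply: cvg_at_left_filter; exact: cF.
  - by move=> x; rewrite in_itv/= => /dF ?; rewrite derive1E derive_val.
rewrite /F sqrrN subrr !(mul0r,mulr0) sube0.
have mI : measurable ([set` `[- a, a]] : set (measurableTypeR R)) by exact: measurable_itv.
have fE x : (f x)%:E = (((n%:R + 1) * a ^+ 2)%:E * (x ^+ n * w x)%:E -
    (n%:R + 4)%:E * (x ^+ n.+2 * w x)%:E)%E by rewrite -!EFinM -EFinB.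
under eq_integral do rewrite fE.
have i1 := integrableZl mI ((n%:R + 1) * a ^+ 2) (integrable_exp_semicircle n).
have i2 := integrableZl mI (n%:R + 4) (integrable_exp_semicircle n.+2).
rewrite integralB// !integralZl//; try exact: integrable_exp_semicircle.
rewrite -(fineK (integral_exp_semicircle_fin_num n)).
rewrite -(fineK (integral_exp_semicircle_fin_num n.+2)) -!EFinM -EFinB => -[/eqP].
by rewrite subr_eq0 => /eqP ->.
Qed.

(** The recursion above, for even exponents, is the recursion that defines the
    tree coefficients. *)
Lemma integral_semicircle_moment (s : R) n : a ^+ 2 = 2 * s ->
  (\int[lebesgue]_(x in `[(- a)%R, a]) (x ^+ n.*2 * w x)%:E =
   (pi * s * tree_coef s n.+1)%:E)%E.
Proof.
move=> a2; elim: n => [|n IH].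
  under eq_integral do rewrite expr0 mul1r.
  by rewrite integral_semicircle tree_coef1 a2; congr EFin; field.
have := integral_exp_semicircle_rec n.*2; rewrite -doubleS IH -EFinM.
set I := (\int[_]_(_ in _) _)%E; move=> e.
have fI : I \is a fin_num by exact: integral_exp_semicircle_fin_num.
have n4 : n.*2%:R + 4 != 0 :> R by rewrite -natrD pnatr_eq0 addnS.
rewrite -(fineK fI) -EFinM in e *; case: e => e; congr EFin.
apply: (mulfI n4); rewrite e.
have h2 : (n%:R + 2) * tree_coef s n.+2 = s * (2 * n%:R + 1) * tree_coef s n.+1.
  have := tree_coefS s n.+1; rewrite /= addr0 -[n.+2]addn2 natrD => ->.
  by rewrite -natr1; ring.
have -> : n.*2%:R = 2 * n%:R :> R by rewrite -mul2n natrM.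
transitivity (2 * pi * s * ((n%:R + 2) * tree_coef s n.+2)); last by ring.
by rewrite h2 a2; ring.
Qed.
End Semicircle.

(** * Moments and existence of the Kesten measure *)

Lemma r_E (R : realType) (p q : R) n : r_ p q n = forest_coef (p + q) n.
Proof.
case: n => [//|n]; rewrite /r_ /weight sum_ordered_noncrossing_pair// mulKf//.
Qed.

Section NormalizedMeasure.
Context d (T : measurableType d) (R : realType) (m : {measure set T -> \bar R}).
Hypothesis m1 : m setT = 1%E.

Let m_copy : set T -> \bar R := m.
HB.instance Definition _ := Measure.on m_copy.
HB.instance Definition _ := @Measure_isProbability.Build _ _ R m_copy m1.

Lemma exists_probability : exists P : probability T R, forall A, P A = m A.
Proof. by exists (m_copy : probability T R). Qed.
End NormalizedMeasure.

Section Kesten.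
Variables (R : realType) (p q : R).
Hypotheses (hp : 0 <= p) (hq : 0 <= q) (hpq : 0 < p + q).
Local Notation T := (measurableTypeR R).
Local Notation s := (p + q).
Local Notation a := (Num.sqrt (2 * (p + q))).
Local Notation f := (kesten_density p q).
Local Notation alpha := (kesten_atom p q).
Local Notation lebesgue := (@lebesgue_measure R).

Let a0 : 0 < a. Proof. by rewrite sqrtr_gt0 mulr_gt0. Qed.
Let a2 : a ^+ 2 = 2 * s. Proof. by rewrite sqr_sqrtr// mulr_ge0// ltW. Qed.
Let mf : measurable_fun [set: T] (f : T -> R).
Proof. exact: measurable_kesten_density. Qed.
Let f0 x : 0 <= f x. Proof. exact: kesten_density_ge0. Qed.

Lemma kesten_semicircle x : Num.sqrt (2 * (p + q) - x ^+ 2) = semicircle a x.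
Proof. by rewrite /semicircle a2. Qed.

Lemma kesten_density_out x : ~~ (- a <= x <= a) -> f x = 0.
Proof. by rewrite /kesten_density => /negbTE->. Qed.

Lemma kesten_denom x : - a <= x <= a ->
  2 - (2 - p - q) * x ^+ 2 = 2 * ((semicircle a x ^+ 2 + (1 - s) ^+ 2 * x ^+ 2) / a ^+ 2).
Proof.
by move=> xa; rewrite sqr_semicircle// a2; field; rewrite gt_eqF.
Qed.

(** At a zero of the denominator the square root w in the numerator vanishes too:
    the denominator is a positive multiple of
    w ^ 2 + (1 - s) ^ 2 x ^ 2. *)
Lemma kesten_density_denom x : - a <= x <= a ->
  f x * (2 - (2 - p - q) * x ^+ 2) = pi^-1 * semicircle a x.
Proof.
move=> xa; rewrite /kesten_density xa /semicircle a2 -mulrA; congr (_ * _).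
have [D0|D0] := eqVneq (2 - (2 - p - q) * x ^+ 2) 0; last by rewrite divfK.
rewrite D0 mulr0; apply/esym/eqP; rewrite -sqrf_eq0 -[X in Num.sqrt (X - _)]a2 -/(semicircle a x).
have E0 : semicircle a x ^+ 2 + (1 - s) ^+ 2 * x ^+ 2 = 0.
  move: D0; rewrite kesten_denom// => /eqP.
  by rewrite !mulf_eq0 invr_eq0 pnatr_eq0/= !mulf_eq0 (gt_eqF a0) !orbF => /eqP.
have := sqr_ge0 (semicircle a x); have := mulr_ge0 (sqr_ge0 (1 - s)) (sqr_ge0 x).
by rewrite eq_le => h1 h2; apply/andP; split; lra.
Qed.

Lemma integral_kesten_restrict (g : R -> R) :
  (\int[lebesgue]_x (g x * f x)%:E = \int[lebesgue]_(x in `[(- a)%R, a]) (g x * f x)%:E)%E.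
Proof.
rewrite [RHS]integral_mkcond; apply: eq_integral => x _; rewrite patchE.
by rewrite mem_setE in_itv/=; case: ifPn => // /kesten_density_out ->; rewrite mulr0.
Qed.

(** On the open interval the density is a multiple of the function of
    [integral_semicircle_ratio] for k = |1 - s|. *)
Lemma kesten_density_mass :
  (\int[lebesgue]_x (f x)%:E = (s / (1 + `|1 - s|))%:E)%E.
Proof.
set X := (LHS).
have k1 : 1 + `|1 - s| != 0 by rewrite gt_eqF// ltr_pwDl.
have pi0 : pi != 0 :> R by rewrite gt_eqF// pi_gt0.
have e : ((2 * pi)%:E * X = (pi * a ^+ 2 / (1 + `|1 - s|))%:E)%E.
  rewrite -(@integral_semicircle_ratio R a a0 `|1 - s|
    (fun x => (semicircle a x ^+ 2 + `|1 - s| ^+ 2 * x ^+ 2) / a ^+ 2))//.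
  have -> : X = (\int[lebesgue]_(x in `](- a)%R, a[) (f x)%:E)%E.
    rewrite integral_itvoo_itvcc//.
    transitivity (\int[lebesgue]_x (1 * f x)%:E)%E.
      by apply: eq_integral => x _; rewrite mul1r.
    by rewrite integral_kesten_restrict; apply: eq_integral => x _; rewrite mul1r.
  have mI : measurable ([set` `]- a, a[] : set T) by exact: measurable_itv.
  have mfI : measurable_fun [set` `]- a, a[] (fun x : T => (f x)%:E).
    by apply/measurable_EFinP; exact: measurable_funTS.
  rewrite -(ge0_integralZl _ mI mfI); last 2 first.
  - by move=> x _; rewrite lee_fin.
  - by rewrite lee_fin mulr_ge0// pi_ge0.
  apply: eq_integral => x; rewrite inE/= in_itv/= => /andP[x1 x2].
  have xa : - a <= x <= a by rewrite !ltW.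
  rewrite -EFinM real_normK ?num_real//; congr EFin.
  set E := semicircle a x ^+ 2 + _.
  have E0 : E != 0.
    rewrite gt_eqF// ltr_pwDl ?exprn_gt0 ?semicircle_gt0// ?x1//.
    by rewrite -exprMn sqr_ge0.
  have -> : f x = pi^-1 * (semicircle a x / (2 * (E / a ^+ 2))).
    by rewrite /kesten_density xa kesten_denom// kesten_semicircle.
  by move: (pi : R) pi0 => P P0; field; rewrite P0 E0 gt_eqF.
have -> : (X = ((2 * pi)^-1)%:E * ((2 * pi)%:E * X))%E.
  by rewrite muleA -EFinM mulVf ?mul1e// mulf_neq0.
by rewrite e -EFinM a2; congr EFin; move: (pi : R) pi0 => P P0; field; rewrite k1 P0.
Qed.

Lemma integrable_exp_kesten n : lebesgue.-integrable setT (fun x : T => (x ^+ n * f x)%:E).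
Proof.
have i0 : lebesgue.-integrable setT (fun x : T => (f x)%:E).
  apply/integrableP; split; first exact/measurable_EFinP.
  rewrite (eq_integral (fun x : T => (f x)%:E)); last first.
    by move=> x _; rewrite abse_EFin ger0_norm.
  by rewrite kesten_density_mass ltry.
apply: (le_integrable measurableT _ _ (integrableZl measurableT (a ^+ n) i0)).
  by apply/measurable_EFinP; apply: measurable_funM => //; exact: measurable_funX.
move=> x _; rewrite -EFinM !abse_EFin lee_fin !normrM.
have [xa|/kesten_density_out ->] := boolP (- a <= x <= a); last by rewrite normr0 !mulr0.
rewrite ler_wpM2r// !normrX lerXn2r ?nnegrE// (ger0_norm (ltW a0)).
by rewrite ler_norml.
Qed.

Lemma integral_kesten_rec n :
  (2%:E * \int[lebesgue]_x (x ^+ n.*2 * f x)%:E -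
   (2 - s)%:E * \int[lebesgue]_x (x ^+ n.+1.*2 * f x)%:E =
   (s * tree_coef s n.+1)%:E)%E.
Proof.
rewrite -!integralZl//; try exact: integrable_exp_kesten.
rewrite -integralB//; try (apply: integrableZl => //; exact: integrable_exp_kesten).
transitivity (\int[lebesgue]_x (x ^+ n.*2 * (2 - (2 - p - q) * x ^+ 2) * f x)%:E)%E.
  apply: eq_integral => x _; rewrite -!EFinM -EFinB; congr EFin.
  by rewrite doubleS !exprS; ring.
rewrite integral_kesten_restrict.
transitivity (\int[lebesgue]_(x in `[(- a)%R, a]) (pi^-1%:E * (x ^+ n.*2 * semicircle a x)%:E))%E.
  apply: eq_integral => x; rewrite inE/= in_itv/= => xa; rewrite -EFinM; congr EFin.
  by rewrite -mulrA [_ * f x]mulrC kesten_density_denom//; ring.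
have mI : measurable ([set` `[- a, a]] : set T) by exact: measurable_itv.
rewrite (integralZl mI); last exact: integrable_exp_semicircle.
rewrite (@integral_semicircle_moment _ _ a0 s)// -EFinM; congr EFin.
have : pi != 0 :> R by rewrite gt_eqF// pi_gt0.
by move: (pi : R) => P P0; field.
Qed.

Section Measure.
Variables (mu : probability T R) (c : R).
Hypotheses (c_gt0 : s < 1 -> 0 < c) (c_eq0 : 1 <= s -> c = 0)
  (muE : forall A : set T, measurable A ->
    (mu A = \int[@lebesgue_measure R]_(x in A) (f x)%:E
         + c%:E * (\d_alpha A + \d_(- alpha)%R A))%E).

Let c0 : 0 <= c.
Proof. by have [/c_gt0/ltW|/c_eq0->] := ltP s 1. Qed.

Definition kesten_even_moment n : R :=
  fine (\int[lebesgue]_x (x ^+ n.*2 * f x)%:E)%E + c * (alpha ^+ n.*2 *+ 2).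

Let ev n (x : R) : 0 <= x ^+ n.*2.
Proof. by rewrite -mul2n exprM exprn_ge0// sqr_ge0. Qed.

Let fin n : (\int[lebesgue]_x (x ^+ n.*2 * f x)%:E)%E \is a fin_num.
Proof. exact: (integrable_fin_num measurableT (integrable_exp_kesten n.*2)). Qed.

Let mX n : measurable_fun [set: T] (fun x : T => (x ^+ n)%:E).
Proof. by apply/measurable_EFinP; exact: exprn_measurable. Qed.

Lemma integral_even_moment n :
  (\int[mu]_x (x ^+ n.*2)%:E = (kesten_even_moment n)%:E)%E.
Proof.
rewrite (ge0_integral_kesten hp hq c0 muE)//; last by move=> x; rewrite lee_fin.
rewrite /kesten_even_moment EFinD fineK//; congr (_ + _)%E.
by rewrite -EFinD -EFinM -mul2n [in (- alpha) ^+ _]exprM sqrrN -exprM mulr2n.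
Qed.

(** The atoms do not contribute, since 2 - (2 - s) x ^ 2 vanishes there. *)
Lemma kesten_even_moment_rec n :
  2 * kesten_even_moment n - (2 - s) * kesten_even_moment n.+1 = s * tree_coef s n.+1.
Proof.
have := integral_kesten_rec n.
rewrite -(fineK (fin n)) -(fineK (fin n.+1)) -!EFinM -EFinB => -[<-].
rewrite /kesten_even_moment.
have e : c * (2 - (2 - s) * alpha ^+ 2) = 0.
  have [s1|/c_eq0->] := ltP s 1; last by rewrite mul0r.
  rewrite /kesten_atom exprVn sqr_sqrtr; last by rewrite subr_ge0 ler_pdivrMr//; lra.
  have -> : 1 - s / 2 = (2 - s) / 2 by field.
  by rewrite invf_div [(2 - s) * _]mulrC divfK ?subrr ?mulr0// gt_eqF// subr_gt0; lra.
rewrite doubleS !exprS; set A := fine _; set B := fine _.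
transitivity (2 * A - (2 - s) * B + 2 * alpha ^+ n.*2 * (c * (2 - (2 - s) * alpha ^+ 2))).
  by ring.
by rewrite e mulr0 addr0.
Qed.

(** For s distinct from 2 the recursion determines the moments from the total
    mass. For s = 2 it gives each moment directly, and the same holds for
    the forest coefficients. *)
Lemma kesten_even_momentE n : kesten_even_moment n = forest_coef s n.
Proof.
have m0 : kesten_even_moment 0 = 1.
  have := integral_even_moment 0; rewrite (eq_integral (cst 1%E : T -> \bar R)); last first.
    by move=> x _; rewrite expr0.
  rewrite integral_cst// mul1e => e.
  by have := etrans (esym e) (probability_setT mu) => -[].
have [s2|s2] := eqVneq s 2.
  have := kesten_even_moment_rec n; have := forest_coef_rec2 s n.
  rewrite s2 subrr !mul0r subr0 => /esym/eqP; rewrite subr_eq0 => /eqP <-.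
  by apply: mulfI; rewrite pnatr_eq0.
elim: n => [//|n IH].
have := kesten_even_moment_rec n; rewrite IH => e.
apply: (@mulfI _ (2 - s)); first by rewrite subr_eq0 eq_sym.
by rewrite forest_coef_rec2 -e; ring.
Qed.

(** Even powers have finite integral; the others are dominated through
    |x| ^ n <= 1 + x ^ (2 n). *)
Lemma kesten_integrable_exp n : mu.-integrable setT (fun x : T => (x ^+ n)%:E).
Proof.
have ie k : mu.-integrable setT (fun x : T => (x ^+ k.*2)%:E).
  apply/integrableP; split => //.
  rewrite (eq_integral (fun x : T => (x ^+ k.*2)%:E)); last first.
    by move=> x _; rewrite abse_EFin ger0_norm.
  by rewrite integral_even_moment ltry.
apply: (le_integrable measurableT _ _ (integrableD measurableT (ie 0%N) (ie n))) => //.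
move=> x _; rewrite -EFinD !abse_EFin lee_fin expr0 (ger0_norm (addr_ge0 ler01 (ev n x))).
rewrite normrX -[x ^+ n.*2]ger0_norm// normrX -muln2 exprM.
have := sqr_ge0 (`|x| ^+ n - 2^-1); nra.
Qed.

Lemma integral_odd_moment n : odd n -> (\int[mu]_x (x ^+ n)%:E = 0)%E.
Proof.
move=> on.
have mN : measurable_fun [set: T] (-%R : T -> T) by exact: oppr_measurable.
have iN : mu.-integrable (-%R @^-1` setT) ((fun x : T => (x ^+ n)%:E) \o (-%R : T -> T)).
  have := integrableN (kesten_integrable_exp n).
  rewrite preimage_setT; apply: eq_integrable => // x _.
  by rewrite /= exprNn -signr_odd on expr1 mulN1r EFinN.
have e : (\int[mu]_x (x ^+ n)%:E = - \int[mu]_x (x ^+ n)%:E)%E.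
  transitivity (\int[pushforward mu (-%R : T -> T)]_x (x ^+ n)%:E)%E.
    apply: eq_measure_integral => A mA _.
    exact: (esym (kesten_measureN hp hq muE mA)).
  rewrite (integral_pushforward mN (mX n) iN measurableT) preimage_setT.
  rewrite -mulN1e -(integralZl measurableT (kesten_integrable_exp n) (-1)).
  by apply: eq_integral => x _; rewrite /= exprNn -signr_odd on expr1 -EFinM.
have fi : (\int[mu]_x (x ^+ n)%:E)%E \is a fin_num.
  exact: (integrable_fin_num measurableT (kesten_integrable_exp n)).
rewrite -(fineK fi) in e *; case: e => e; congr EFin; move: e.
by set I := fine _ => e; lra.
Qed.

Lemma kesten_has_moments : has_moments mu (m_ p q).
Proof.
move=> n; split; first exact: kesten_integrable_exp.
rewrite /m_; case: ifPn => [|on]; first exact: integral_odd_moment.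
by rewrite r_E -kesten_even_momentE -integral_even_moment even_halfK.
Qed.

Lemma kesten_support : mu (~` `[- (a + `|alpha|), a + `|alpha|]) = 0%E.
Proof.
set D := [set` _]; have mD : measurable D by exact: measurable_itv.
rewrite muE; last exact: measurableC.
rewrite integral0_eq => [|x Dx]; last first.
  congr EFin; apply: kesten_density_out; apply: contra_notN Dx => /andP[x1 x2].
  rewrite /D /= in_itv/= (le_trans _ x1) ?(le_trans x2)// ?lerDl//.
  by rewrite lerN2 lerDl.
have D1 (x : R) : `|x| = `|alpha| -> \d_x (~` D : set T) = 0%E :> \bar R.
  move=> xa; rewrite diracE memNset// => Dx; apply: Dx.
  by rewrite /D /= in_itv/= -ler_norml xa lerDr ltW.
by rewrite !D1 ?normrN // adde0 mule0 adde0.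
Qed.

End Measure.

(** For s < 1 the missing mass 1 - s / (2 - s) is shared by the two atoms. *)
Lemma exists_kesten : exists mu : probability T R, is_kesten p q mu.
Proof.
pose c : R := if s < 1 then (1 - s) / (2 - s) else 0.
have c0 : 0 <= c.
  by rewrite /c; case: ltP => // s1; rewrite divr_ge0// subr_ge0; lra.
have [nu nuE] := exists_density_measure lebesgue mf f0.
pose atoms : {measure set T -> \bar R} :=
  mscale (NngNum c0) (measure_add (\d_(alpha : T)) (\d_((- alpha)%R : T))).
have mE A : measure_add nu atoms A = (\int[lebesgue]_(x in A) (f x)%:E
         + c%:E * (\d_alpha A + \d_(- alpha)%R A))%E.
  apply: etrans (measure_addE nu atoms A) _; rewrite nuE; congr (_ + _ * _)%E.
  exact: (measure_addE (\d_(alpha : T)) (\d_((- alpha)%R : T)) A).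
have [|mu muE] := @exists_probability _ T R (measure_add nu atoms).
  apply: etrans (mE setT) _; rewrite kesten_density_mass !diracT.
  rewrite (_ : 1 + 1 = 2%:E)%E // -EFinM -EFinD; congr EFin.
  rewrite /c; case: ltP => s1.
    rewrite ger0_norm; last lra.
    by field; rewrite gt_eqF//; lra.
  rewrite ler0_norm ?subr_le0// mul0r addr0 (_ : 1 + - (1 - s) = s); last by ring.
  by rewrite divff// gt_eqF.
exists mu, c; split => [s1|s1|A mA].
- by rewrite /c s1 divr_gt0// subr_gt0//; lra.
- by rewrite /c ltNge s1.
- by rewrite muE; exact: mE.
Qed.

End Kesten.

Theorem theorem2p1 (R : realType) (p q : R)
    (hp : 0 <= p) (hq : 0 <= q) (hpq : 0 < p + q) :
  (exists mu : probability (measurableTypeR R) R, is_kesten p q mu) /\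
  (forall mu : probability (measurableTypeR R) R, is_kesten p q mu ->
     has_moments mu (m_ p q) /\
     (forall nu : probability (measurableTypeR R) R, has_moments nu (m_ p q) ->
        forall A : set (measurableTypeR R), measurable A -> nu A = mu A)).
Proof.
split; first exact: exists_kesten.
move=> mu [c [c_gt0 c_eq0 muE]].
have hm := kesten_has_moments hp hq hpq c_gt0 c_eq0 muE.
split => // nu hn A mA; apply/esym.
apply: (moments_determine _ (kesten_support hpq muE)) => //.
- by rewrite ltr_pwDl// sqrtr_gt0 mulr_gt0.
- by move=> n; case: (hm n).
- by move=> n; case: (hn n).
- by move=> n; have [_ ->] := hm n; have [_ ->] := hn n.
Qed.
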